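(* For $n\geq 1$ write $\Theta_n:=[\Theta_n]\in\Omega_{\mathrm U}^{-2n}$ for the cobordism class of a smooth theta divisor of complex dimension $n$. (i) Let $K\in\Omega_{\mathrm U}^{-12}$ be $$K=\Theta_6+9\Theta_1^6-15\Theta_1^4\Theta_2-3\Theta_1^3\Theta_3-13\Theta_1^2\Theta_2^2+3\Theta_1^2\Theta_4+29\Theta_1\Theta_2\Theta_3+10\Theta_2^3-11\Theta_2\Theta_4-10\Theta_3^2.$$ Then $$\mathrm{Bc}(K)=-360a_3\in\mathbb Z[a_1,a_2,a_3],\qquad \mathrm{Kr}(K)=0\in A\otimes\mathbb Q\cong\mathbb Q[\alpha,\wp(z),\wp'(z),g_2].$$ (ii) The $\mathbb Q$-vector space $$\mathrm{Ker}\bigl(\mathrm{Kr}:\Omega_{\mathrm U}^{-12}\otimes\mathbb Q\to\mathbb Q[\alpha,\wp(z),\wp'(z),g_2]\bigr)$$ is $2$-dimensional and is generated by $K$ and $$L=\Theta_5\Theta_1-3\Theta_4\Theta_1^2-11\Theta_3\Theta_2\Theta_1+12\Theta_3\Theta_1^3+22\Theta_2^2\Theta_1^2-30\Theta_2\Theta_1^4+9\Theta_1^6.$$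
   Context: $\Omega_{\mathrm U}$ is the complex cobordism ring. $\Theta_n$ is a smooth theta divisor on a general principally polarised abelian variety of dimension $n+1$; it is known that $\Omega_{\mathrm U}\otimes\mathbb Q=\mathbb Q[\Theta_1,\Theta_2,\dots]$ and that the exponential of the universal formal group law of complex cobordism is $u+\sum_{n\ge1}\Theta_n\frac{u^{n+1}}{(n+1)!}$. Hence a genus $\phi$ whose formal group law has exponential $f$ satisfies $f(u)=u+\sum_{n\ge1}\phi(\Theta_n)\frac{u^{n+1}}{(n+1)!}$. The Buchstaber genus $\mathrm{Bc}:\Omega_{\mathrm U}\to\mathbb Z[\frac12,a_1,a_2,a_3]$ has as exponential the compositional inverse of $\int_0^u\frac{dt}{\sqrt{1-a_1t^2+a_2t^4-a_3t^6}}$. The Krichever genus $\mathrm{Kr}:\Omega_{\mathrm U}\to A$ is the genus of the universal formal group law of the form $\frac{u^2\lambda_1(v)-v^2\lambda_1(u)}{u\lambda_2(v)-v\lambda_2(u)}$, where $A$ is the ring generated by the coefficients of the series $\lambda_1,\lambda_2$; $A\otimes\mathbb Q\cong\mathbb Q[\alpha,\wp(z),\wp'(z),g_2]$ is a polynomial ring in four algebraically independent generators. Over $A\otimes\mathbb Q$ the exponential is $$f_{\mathrm{Kr}}(x)=\frac{e^{\alpha x}}{\Phi(x,z)},\qquad\Phi(x,z)=\frac{\sigma(z-x)}{\sigma(z)\sigma(x)}e^{\zeta(z)x},$$ with $\sigma(\cdot)=\sigma(\cdot;g_2,g_3)$, $\zeta=(\log\sigma)'$, $\wp=-\zeta'$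 the Weierstrass functions, expanded as a power series in $x$ with coefficients polynomial in $\alpha,\wp(z),\wp'(z),g_2$, where $g_3=4\wp(z)^3-g_2\wp(z)-\wp'(z)^2$. In (i) and (ii) $\mathrm{Kr}$ is understood after tensoring with $\mathbb Q$. *)

(* Defs.v *)
From HB Require Import structures.
From mathcomp Require Import all_boot all_order all_algebra.
From mathcomp Require Import zify boolp.
From mathcomp Require Import finmap monalg.

Set Implicit Arguments.
Unset Strict Implicit.
Unset Printing Implicit Defensive.

Import Order.TTheory GRing.Theory Num.Theory.

Local Open Scope ring_scope.

(* A formal power series is its coefficient function; a series in two         *)
(* variables is a function nat -> nat -> R.                                   *)
Section PowerSeries.
Variable R : comNzRingType.
Implicit Types (f g e l : nat -> R) (F : nat -> nat -> R) (k m n : nat).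

Definition fps_one : nat -> R := fun n => (n == 0%N)%:R.
Definition fps_X : nat -> R := fun n => (n == 1%N)%:R.
Definition fps_mul f g : nat -> R :=
  fun n => \sum_(i < n.+1) f i * g (n - i)%N.
Definition fps_pow f k : nat -> R := iter k (fps_mul f) fps_one.
Definition fps_deriv f : nat -> R := fun n => f n.+1 *+ n.+1.

(* f (g u), for g 0 = 0: the powers g ^ k with k > n do not contribute        *)
Definition fps_comp f g : nat -> R :=
  fun n => \sum_(k < n.+1) f k * fps_pow g k n.

(* The compositional inverse r of f = u + f_2 u^2 + ... is determined by      *)
(* r_m = [m = 1] - \sum_(2 <= k <= m) f_k (r^k)_m, where (r^k)_m with k >= 2  *)
(* involves only the r_i with i < m.                                          *)
Fixpoint fps_rev_seq f n : seq R :=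
  if n is m.+1 then
    let s := fps_rev_seq f m in
    rcons s ((m == 1%N)%:R - \sum_(2 <= k < m.+1) f k * fps_pow (nth 0 s) k m)
  else [::].
Definition fps_rev f : nat -> R := fun n => nth 0 (fps_rev_seq f n.+1) n.

(* The coefficients of f (f^-1 x + f^-1 y)                                    *)
Definition fgl_of_exp f : nat -> nat -> R := fun i j =>
  \sum_(k < (i + j).+1) f k *
    \sum_(l < k.+1)
      (fps_pow (fps_rev f) l i * fps_pow (fps_rev f) (k - l) j) *+ 'C(k, l).

(* f is an exponential of F: f = u + ... and F (f x, f y) = f (x + y),        *)
(* compared coefficientwise on x^m y^n                                        *)
Definition is_exponential F f : Prop :=
  [/\ f 0%N = 0, f 1%N = 1 &
      forall m n,
        \sum_(i < m.+1) \sum_(j < n.+1) F i j * fps_pow f i m * fps_pow f j n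
        = f (m + n)%N *+ 'C(m + n, m)].

Let tr n f : {poly R} := \poly_(i < n) f i.

Lemma tr_mul f g n N : (n < N)%N -> (tr N f * tr N g)`_n = fps_mul f g n.
Proof.
move=> lt_nN; rewrite coefM; apply: eq_bigr => i _.
by rewrite !coef_poly (leq_ltn_trans (leq_subr _ _) lt_nN)
           (leq_ltn_trans _ lt_nN) // -ltnS.
Qed.

Lemma fps_mulC f g : fps_mul f g =1 fps_mul g f.
Proof. by move=> n; rewrite -!(@tr_mul _ _ n n.+1) // mulrC. Qed.

Lemma eq_fps_mul f f' g g' n :
    (forall i, (i <= n)%N -> f i = f' i) ->
    (forall i, (i <= n)%N -> g i = g' i) ->
  fps_mul f g n = fps_mul f' g' n.
Proof.
move=> ff' gg'; apply: eq_bigr => i _.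
by rewrite ff' ?gg' ?leq_subr // -ltnS.
Qed.

Lemma fps_mulA f g h : fps_mul f (fps_mul g h) =1 fps_mul (fps_mul f g) h.
Proof.
move=> n; have lt_n : (n < n.+1)%N by [].
have trM u v i : (i <= n)%N -> fps_mul u v i = (tr n.+1 u * tr n.+1 v)`_i.
  by move=> le_in; rewrite tr_mul.
transitivity ((tr n.+1 f * (tr n.+1 g * tr n.+1 h))`_n).
  rewrite coefM; apply: eq_bigr => i _.
  by rewrite coef_poly ltn_ord trM ?leq_subr.
rewrite mulrA coefM; apply: eq_bigr => i _.
by rewrite trM -1?ltnS // coef_poly ltnS leq_subr.
Qed.

Lemma fps_mul1 f : fps_mul f fps_one =1 f.
Proof.
move=> n; rewrite /fps_mul big_ord_recr /= subnn /fps_one mulr1 big1 ?add0r //.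
by move=> i _; rewrite subn_eq0 leqNgt ltn_ord mulr0.
Qed.

Lemma fps_powS f k n : fps_pow f k.+1 n = fps_mul f (fps_pow f k) n.
Proof. by []. Qed.

Lemma fps_pow_lt f k n : f 0%N = 0 -> (n < k)%N -> fps_pow f k n = 0.
Proof.
move=> f0; elim: k n => // k IHk n lt_nk; rewrite fps_powS /fps_mul big1 // => i _.
case: (posnP i) => [-> | i_gt0]; first by rewrite f0 mul0r.
by rewrite IHk ?mulr0 //; case: i i_gt0 => -[|i] //= lt_i _; lia.
Qed.

Lemma fps_pow_agree f g k n :
    (forall i, (i < n)%N -> f i = g i) ->
  forall i, (i < n)%N -> fps_pow f k i = fps_pow g k i.
Proof.
move=> fg; elim: k => // k IHk i lt_in; rewrite !fps_powS.
by apply: eq_fps_mul => j le_ji; [apply: fg | apply: IHk]; apply: leq_ltn_trans lt_in.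
Qed.

Lemma fps_pow_agree2 f g k n :
    f 0%N = 0 -> g 0%N = 0 -> (forall i, (i < n)%N -> f i = g i) -> (1 < k)%N ->
  fps_pow f k n = fps_pow g k n.
Proof.
case: k => [|[|k]] // f0 g0 fg _; rewrite fps_powS [RHS]fps_powS.
apply: eq_bigr => i _.
case: (posnP i) => [-> | i_gt0]; first by rewrite f0 g0 !mul0r.
have [lt_in | ge_in] := ltnP i n.
  by rewrite fg // (@fps_pow_agree f g _ n) // ltn_subrL i_gt0 (leq_trans _ lt_in).
have -> : (n - i = 0)%N by apply/eqP; rewrite subn_eq0.
by rewrite !fps_pow_lt ?mulr0.
Qed.

Lemma size_fps_rev_seq f n : size (fps_rev_seq f n) = n.
Proof. by elim: n => //= n IHn; rewrite size_rcons IHn. Qed.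

Lemma nth_fps_rev_seq f n i :
  nth 0 (fps_rev_seq f n) i = if (i < n)%N then fps_rev f i else 0.
Proof.
elim: n => [|n IHn] /=; first by rewrite nth_nil.
rewrite nth_rcons size_fps_rev_seq IHn ltnS.
case: (ltngtP i n) => // ->.
by rewrite /fps_rev /= nth_rcons size_fps_rev_seq ltnn eqxx.
Qed.

Lemma fps_revE f m : fps_rev f m =
  (m == 1%N)%:R -
  \sum_(2 <= k < m.+1) f k * fps_pow (nth 0 (fps_rev_seq f m)) k m.
Proof. by rewrite /fps_rev /= nth_rcons size_fps_rev_seq ltnn eqxx. Qed.

Lemma fps_rev0 f : fps_rev f 0 = 0.
Proof. by rewrite fps_revE big_geq // subr0. Qed.

Lemma fps_rev1 f : fps_rev f 1 = 1.
Proof. by rewrite fps_revE big_geq // subr0. Qed.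

Lemma fps_comp_rev f :
  f 0%N = 0 -> f 1%N = 1 -> fps_comp f (fps_rev f) =1 fps_X.
Proof.
move=> f0 f1 n; rewrite /fps_comp -(big_mkord xpredT (fun k => f k * fps_pow _ k n)).
rewrite big_ltn // f0 mul0r add0r; case: n => [|n]; first by rewrite big_geq.
rewrite big_ltn // f1 mul1r fps_powS fps_mul1 fps_revE /fps_X.
rewrite -addrA addrC -[RHS]add0r; congr (_ + _).
rewrite addrC -sumrB big_nat big1 // => k /andP[lt_1k _].
rewrite -mulrBr (@fps_pow_agree2 (fps_rev f) (nth 0 (fps_rev_seq f n.+1))) //.
- by rewrite subrr mulr0.
- exact: fps_rev0.
- by rewrite nth_fps_rev_seq fps_rev0.
- by move=> i lt_in; rewrite nth_fps_rev_seq lt_in.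
Qed.

Lemma fps_derivM f g n : fps_deriv (fps_mul f g) n =
  fps_mul (fps_deriv f) g n + fps_mul f (fps_deriv g) n.
Proof.
have trD h : (tr n.+2 h)^`() = tr n.+1 (fps_deriv h).
  apply/polyP=> i; rewrite coef_deriv !coef_poly !ltnS.
  by case: ifP => // _; rewrite mul0rn.
have tr2 h i : (i <= n)%N -> (tr n.+2 h)`_i = h i.
  by move=> le_in; rewrite coef_poly ltnS (leq_trans le_in).
have tr1 h i : (i <= n)%N -> (tr n.+1 h)`_i = h i.
  by move=> le_in; rewrite coef_poly ltnS le_in.
rewrite {1}/fps_deriv -(@tr_mul _ _ n.+1 n.+2) // -coef_deriv derivM coefD !trD.
congr (_ + _); rewrite coefM; apply: eq_bigr => i _.
  by rewrite tr1 ?tr2 ?leq_subr -1?ltnS.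
by rewrite tr2 ?tr1 ?leq_subr -1?ltnS.
Qed.

Lemma fps_derivX f k n :
  fps_deriv (fps_pow f k.+1) n = fps_mul (fps_pow f k) (fps_deriv f) n *+ k.+1.
Proof.
elim: k n => [|k IHk] n.
  rewrite /fps_deriv fps_powS fps_mul1 fps_mulC fps_mul1 mulr1n.
  by [].
rewrite (_ : fps_deriv (fps_pow f k.+2) n =
             fps_deriv (fps_mul f (fps_pow f k.+1)) n) // fps_derivM.
rewrite fps_mulC mulrS; congr (_ + _).
rewrite (@eq_fps_mul f f _
   (fun n => fps_mul (fps_pow f k) (fps_deriv f) n *+ k.+1)) //.
rewrite /fps_mul; under eq_bigr do rewrite mulrnAr.
rewrite sumrMnl; congr (_ *+ _).
exact: fps_mulA.
Qed.

Lemma fps_deriv_comp f g n : g 0%N = 0 ->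
  fps_deriv (fps_comp f g) n = fps_mul (fps_comp (fps_deriv f) g) (fps_deriv g) n.
Proof.
move=> g0; rewrite /fps_deriv /fps_comp -sumrMnl big_ord_recl /=.
rewrite {1}/fps_one mulr0 mul0rn add0r.
under eq_bigr => k _.
  rewrite -mulrnAr (_ : _ *+ _ = fps_deriv (fps_pow g k.+1) n) //.
  rewrite fps_derivX mulrnAr -mulrnAl /fps_mul mulr_sumr.
  over.
rewrite exchange_big /=; apply: eq_bigr => i _.
rewrite mulr_suml (big_ord_widen n.+1 (fun k => f k.+1 *+ k.+1 *
  fps_pow g k i * fps_deriv g (n - i))) //.
rewrite [in RHS]big_mkcond /=; apply: eq_bigr => k _.
case: ltnP => [_|lt_ik]; first by rewrite mulrA.
by rewrite fps_pow_lt // mul0r mulr0.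
Qed.

Lemma fgl_of_exp1 f i :
  fgl_of_exp f i 1 = fps_comp (fps_deriv f) (fps_rev f) i.
Proof.
rewrite /fgl_of_exp addn1 big_ord_recl big_ord1 subnn {2}/fps_pow /= /fps_one.
rewrite mulr0 mul0rn mulr0 add0r; apply: eq_bigr => k _.
rewrite /bump /= add1n big_ord_recr big_ord_recr /= subnn {3}/fps_pow /= /fps_one.
rewrite mulr0 mul0rn addr0 big1 ?add0r => [|l _].
  rewrite subSn // subnn fps_powS fps_mul1 fps_rev1 mulr1 binSn.
  by rewrite /fps_deriv mulrnAl mulrnAr.
by rewrite (@fps_pow_lt _ (k.+1 - l)) ?fps_rev0 ?mulr0 ?mul0rn //; have := ltn_ord l; lia.
Qed.

Lemma exp_deriv_fgl f n : f 0%N = 0 -> f 1%N = 1 ->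
  fps_comp (iter n.+1 fps_deriv f) (fps_rev f) =1
  fps_mul (fps_deriv (fps_comp (iter n fps_deriv f) (fps_rev f)))
          (fun i => fgl_of_exp f i 1).
Proof.
move=> f0 f1 i.
rewrite (@eq_fps_mul _ (fps_mul (fps_comp (iter n.+1 fps_deriv f) (fps_rev f))
                                (fps_deriv (fps_rev f)))
                     _ (fps_comp (fps_deriv f) (fps_rev f))) //; last 2 first.
- by move=> j _; rewrite fps_deriv_comp ?fps_rev0.
- by move=> j _; rewrite fgl_of_exp1.
rewrite -fps_mulA (@eq_fps_mul _ (fps_comp (iter n.+1 fps_deriv f) (fps_rev f))
                               _ fps_one) ?fps_mul1 // => j _.
rewrite fps_mulC -fps_deriv_comp ?fps_rev0 // {1}/fps_deriv fps_comp_rev //.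
by rewrite /fps_X /fps_one eqSS; case: eqP => [->|] //; rewrite mul0rn.
Qed.

Lemma fps_comp0 f g : fps_comp f g 0 = f 0%N.
Proof. by rewrite /fps_comp big_ord1 /fps_pow /= /fps_one mulr1. Qed.

Lemma iter_deriv0 f n : iter n fps_deriv f 0%N = f n *+ n`!.
Proof.
suff H i : iter n fps_deriv f i = f (n + i)%N *+ (n + i) ^_ n.
  by rewrite H addn0 ffactnn.
elim: n i => [|n IHn] i; first by rewrite ffactn0.
rewrite iterS /fps_deriv IHn -mulrnA addnS addSn ffactnSr.
by congr (_ *+ (_ * _)%N); lia.
Qed.

End PowerSeries.

Section RationalPowerSeries.
Variable A : comAlgType rat.
Implicit Types (f g h s : nat -> A) (c : rat) (n : nat).

Definition fps_const (a : A) : nat -> A := fun n => if n is 0 then a else 0.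
Definition fps_linear (a : A) : nat -> A := fun n => if n == 1%N then a else 0.

(* \int_0^u s(t) dt *)
Definition fps_int s : nat -> A :=
  fun n => if n is m.+1 then (m.+1%:R^-1 : rat) *: s m else 0.

(* for h 0 = 0                                                                *)
Definition fps_exp h : nat -> A :=
  fps_comp (fun n => ((n`!)%:R^-1 : rat)%:A) h.

(* h ^ c by the binomial series, for h 0 = 1                                  *)
Definition fps_rpow h c : nat -> A :=
  fps_comp (fun n => ((\prod_(i < n) (c - i%:R)) / (n`!)%:R)%:A)
           (fun n => h n - fps_one A n).

End RationalPowerSeries.

(* The weight of the monomial \prod_i 'X_i ^ m_i is \sum_i m_i (i + 1): the   *)
(* variable 'X_i below is the class of Theta_(i + 1), of degree - 2 (i + 1).  *)
Definition theta_weight (m : {cmonom nat}) : nat :=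
  (\sum_(i <- finsupp m) m i * i.+1)%N.

(* Omega_U (x) Q = Q[Theta_1, Theta_2, ...]                                   *)
Notation OmegaQ := {malg rat[{cmonom nat}]}.

(* Theta_0 is the class of a point.                                           *)
Definition ThetaQ (n : nat) : OmegaQ :=
  if n is i.+1 then mkmalgU (ucm i) 1 else 1.

(* u + \sum_(n >= 1) Theta_n u^(n+1) / (n+1)!                                 *)
Definition exp_OmegaU : nat -> OmegaQ :=
  fun n => if n is m.+1 then (((m.+1)`!)%:R^-1 : rat) *: ThetaQ m else 0.

(* The formal group law of complex cobordism                                  *)
Definition FGL_OmegaQ : nat -> nat -> OmegaQ := fgl_of_exp exp_OmegaU.

(* By Milnor and Quillen, Omega_U is torsion-free and is generated, as a      *)
(* ring, by the coefficients of its formal group law.                         *)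
Inductive in_OmegaU : OmegaQ -> Prop :=
| in_OmegaU_one : in_OmegaU 1
| in_OmegaU_sub x y : in_OmegaU x -> in_OmegaU y -> in_OmegaU (x - y)
| in_OmegaU_mul x y : in_OmegaU x -> in_OmegaU y -> in_OmegaU (x * y)
| in_OmegaU_coef i j : in_OmegaU (FGL_OmegaQ i j).

Definition OmegaU_pred : {pred OmegaQ} := fun x => `[< in_OmegaU x >].

Lemma OmegaU_predP x : reflect (in_OmegaU x) (x \in OmegaU_pred).
Proof. exact: asboolP. Qed.

Lemma OmegaU_subring_closed : subring_closed OmegaU_pred.
Proof.
split=> [|x y /OmegaU_predP xO /OmegaU_predP yO
         |x y /OmegaU_predP xO /OmegaU_predP yO]; apply/OmegaU_predP.
- exact: in_OmegaU_one.
- exact: in_OmegaU_sub.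
- exact: in_OmegaU_mul.
Qed.
HB.instance Definition _ :=
  GRing.isSubringClosed.Build OmegaQ OmegaU_pred OmegaU_subring_closed.

Record OmegaU : predArgType :=
  MkOmegaU { OmegaU_val : OmegaQ; OmegaU_valP : OmegaU_val \in OmegaU_pred }.
HB.instance Definition _ := [isSub for OmegaU_val].
HB.instance Definition _ := [Choice of OmegaU by <:].
HB.instance Definition _ := [SubChoice_isSubComNzRing of OmegaU by <:].

Lemma FGL_in_OmegaU i j : FGL_OmegaQ i j \in OmegaU_pred.
Proof. exact/OmegaU_predP/in_OmegaU_coef. Qed.

Definition FGL_OmegaU : nat -> nat -> OmegaU :=
  fun i j => MkOmegaU (FGL_in_OmegaU i j).

Lemma exp_OmegaU1 : exp_OmegaU 1 = 1.
Proof. by rewrite /exp_OmegaU /= invr1 scale1r. Qed.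

Lemma ThetaQ_in_OmegaU n : ThetaQ n \in OmegaU_pred.
Proof.
pose g k := fps_comp (iter k (@fps_deriv OmegaQ) exp_OmegaU) (fps_rev exp_OmegaU).
have gO k i : g k i \in OmegaU_pred.
  elim: k i => [|k IHk] i.
    rewrite /g (@fps_comp_rev OmegaQ exp_OmegaU (erefl _) exp_OmegaU1).
    exact: rpred_nat.
  rewrite /g (@exp_deriv_fgl OmegaQ exp_OmegaU k (erefl _) exp_OmegaU1 i).
  apply: rpred_sum => j _; apply: rpredM; last exact: FGL_in_OmegaU.
  exact/rpredMn/IHk.
suff -> : ThetaQ n = g n.+1 0%N by [].
rewrite /g fps_comp0 iter_deriv0 /exp_OmegaU -scaler_nat scalerA mulfV ?scale1r //.
by rewrite pnatr_eq0 -lt0n fact_gt0.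
Qed.

Definition Theta n : OmegaU := MkOmegaU (ThetaQ_in_OmegaU n).

(* Omega_U^(-2n) (x) Q and Omega_U^(-2n)                                      *)
Definition in_degreeQ (n : nat) (x : OmegaQ) : Prop :=
  forall m, m \in msupp x -> theta_weight m = n.
Definition in_degree (n : nat) (x : OmegaU) : Prop := in_degreeQ n (val x).

Definition Zhalf_pred : {pred rat} :=
  fun x => `[< exists k : nat, x * 2 ^+ k \is a Num.int >].

Lemma Zhalf_subring_closed : subring_closed Zhalf_pred.
Proof.
split=> [|x y /asboolP[i xi] /asboolP[j yj]|x y /asboolP[i xi] /asboolP[j yj]].
- by apply/asboolP; exists 0%N; rewrite mulr1 rpred1.
- apply/asboolP; exists (i + j)%N; rewrite mulrBl exprD mulrA rpredB //.
    by rewrite rpredM // rpredX // rpred_nat.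
  by rewrite mulrCA rpredM // rpredX // rpred_nat.
- by apply/asboolP; exists (i + j)%N; rewrite exprD mulrACA rpredM.
Qed.
HB.instance Definition _ :=
  GRing.isSubringClosed.Build rat Zhalf_pred Zhalf_subring_closed.

Record Zhalf : predArgType :=
  MkZhalf { Zhalf_val : rat; Zhalf_valP : Zhalf_val \in Zhalf_pred }.
HB.instance Definition _ := [isSub for Zhalf_val].
HB.instance Definition _ := [Choice of Zhalf by <:].
HB.instance Definition _ := [SubChoice_isSubComNzRing of Zhalf by <:].

Definition map_malg (M : monomType) (R S : comNzRingType) (f : R -> S) :
  {malg R[M]} -> {malg S[M]} :=
  mmap (fun c => malgC (f c)) (fun m => mkmalgU m 1).

Section PolynomialVariables.
Variables (R : comNzRingType) (n : nat).
Definition mvar (i : 'I_n) : {malg R[{cmonom 'I_n}]} := mkmalgU (ucm i) 1.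
End PolynomialVariables.

(* R[a_1, a_2, a_3] *)
Notation BcRing R := {malg R[{cmonom 'I_3}]}.
Definition a1 (R : comNzRingType) : BcRing R := mvar R (@Ordinal 3 0 isT).
Definition a2 (R : comNzRingType) : BcRing R := mvar R (@Ordinal 3 1 isT).
Definition a3 (R : comNzRingType) : BcRing R := mvar R (@Ordinal 3 2 isT).

(* 1 - a_1 t^2 + a_2 t^4 - a_3 t^6 *)
Definition Bc_radicand : nat -> BcRing rat := fun n =>
  match n with
  | 0 => 1 | 2 => - a1 rat | 4 => a2 rat | 6 => - a3 rat | _ => 0
  end.

Definition Bc_exp : nat -> BcRing rat :=
  fps_rev (fps_int (fps_rpow Bc_radicand (- 2^-1))).

Definition is_Buchstaber_genus (Bc : {rmorphism OmegaU -> BcRing Zhalf}) : Prop :=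
  is_exponential
    (fun i j => map_malg (val : Zhalf -> rat) (Bc (FGL_OmegaU i j))) Bc_exp.

(* Q[alpha, wp(z), wp'(z), g_2] *)
Notation KrRing := {malg rat[{cmonom 'I_4}]}.
Definition Kr_alpha : KrRing := mvar rat (@Ordinal 4 0 isT).
Definition wp_z : KrRing := mvar rat (@Ordinal 4 1 isT).
Definition wp'_z : KrRing := mvar rat (@Ordinal 4 2 isT).
Definition g2 : KrRing := mvar rat (@Ordinal 4 3 isT).
Definition g3 : KrRing := 4 * wp_z ^+ 3 - g2 * wp_z - wp'_z ^+ 2.

(* wp(x) = x^-2 + \sum_(k >= 2) c_k x^(2k-2) with c_2 = g2 / 20, c_3 = g3 / 28 *)
(* and (2k+1) (k-3) c_k = 3 \sum_(2 <= i <= k-2) c_i c_(k-i) for k >= 4.      *)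
Fixpoint wp_laurent_seq (n : nat) : seq KrRing :=
  if n is k.+1 then
    let s := wp_laurent_seq k in
    rcons s
      match k with
      | 0 | 1 => 0
      | 2 => (20^-1 : rat) *: g2
      | 3 => (28^-1 : rat) *: g3
      | _ => (3 / ((2 * k + 1) * (k - 3))%:R : rat) *:
             \sum_(2 <= i < k - 1) s`_i * s`_(k - i)
      end
  else [::].
Definition wp_laurent (k : nat) : KrRing := (wp_laurent_seq k.+1)`_k.

(* wp(x) - x^-2 *)
Definition wp_regular : nat -> KrRing :=
  fun n => if odd n then 0 else wp_laurent n./2.+1.

(* sigma(x): (log sigma)'' = - wp and sigma(x) = x + O(x^5)                   *)
Definition sigma_series : nat -> KrRing :=
  fps_mul (fps_X _) (fps_exp (fun n => - fps_int (fps_int wp_regular) n)).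

(* The Taylor coefficients P_n of wp(z + x) in x, from wp'' = 6 wp^2 - g2 / 2 *)
Fixpoint wp_taylor_seq (n : nat) : seq KrRing :=
  if n is k.+1 then
    let s := wp_taylor_seq k in
    rcons s
      match k with
      | 0 => wp_z
      | 1 => wp'_z
      | m.+2 => ((m.+2 * m.+1)%:R^-1 : rat) *:
                (6 * \sum_(i < m.+1) s`_i * s`_(m - i)
                 - fps_const ((2^-1 : rat) *: g2) m)
      end
  else [::].
Definition wp_taylor (n : nat) : KrRing := (wp_taylor_seq n.+1)`_n.

(* sigma(z - x) e^(zeta(z) x) / sigma(z): the logarithm of this series in x   *)
(* vanishes to order 2, and its second derivative is - wp(z - x).             *)
Definition sigma_shift : nat -> KrRing :=
  fps_exp (fun n =>
    - fps_int (fps_int (fun m => (-1) ^+ m * wp_taylor m)) n).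

(* e^(alpha x) / Phi(x, z), where Phi(x, z) = sigma_shift(x) / sigma(x)       *)
Definition Kr_exp : nat -> KrRing :=
  fps_mul (fps_exp (fps_linear Kr_alpha))
          (fps_mul sigma_series (fps_rpow sigma_shift (-1))).

Definition is_Krichever_genus (Kr : {rmorphism OmegaQ -> KrRing}) : Prop :=
  is_exponential (fun i j => Kr (FGL_OmegaQ i j)) Kr_exp.

Definition K_class : OmegaU :=
  Theta 6 + 9 * Theta 1 ^+ 6 - 15 * Theta 1 ^+ 4 * Theta 2
  - 3 * Theta 1 ^+ 3 * Theta 3 - 13 * Theta 1 ^+ 2 * Theta 2 ^+ 2
  + 3 * Theta 1 ^+ 2 * Theta 4 + 29 * Theta 1 * Theta 2 * Theta 3
  + 10 * Theta 2 ^+ 3 - 11 * Theta 2 * Theta 4 - 10 * Theta 3 ^+ 2.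

Definition L_class : OmegaU :=
  Theta 5 * Theta 1 - 3 * Theta 4 * Theta 1 ^+ 2
  - 11 * Theta 3 * Theta 2 * Theta 1 + 12 * Theta 3 * Theta 1 ^+ 3
  + 22 * Theta 2 ^+ 2 * Theta 1 ^+ 2 - 30 * Theta 2 * Theta 1 ^+ 4
  + 9 * Theta 1 ^+ 6.

Section Subspaces.
Variable V : lmodType rat.
Implicit Types (S : V -> Prop) (d : nat).

Definition generated_by d S (b : 'I_d -> V) : Prop :=
  forall x, S x <-> exists c : 'I_d -> rat, x = \sum_i c i *: b i.
Definition lin_independent d (b : 'I_d -> V) : Prop :=
  forall c : 'I_d -> rat, \sum_i c i *: b i = 0 -> forall i, c i = 0.
Definition has_dimension S d : Prop :=
  exists b : 'I_d -> V, generated_by S b /\ lin_independent b.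
End Subspaces.

Definition Kr_kernel (Kr : {rmorphism OmegaQ -> KrRing}) (n : nat) : OmegaQ -> Prop :=
  fun x => in_degreeQ n x /\ Kr x = 0.

(* Main.v *)
(* Let F have exponential f. Differentiating F (f x, f y) = f (x + y) in y at
   y = 0 gives f' = F_1 (f), where F_1 = \sum_i F_(i,1) x^i; hence the n-th
   derivative of f is h_n (f) with h_0 = x and h_(n+1) = h_n' F_1, and
   n! f_n = h_n (0) is a universal polynomial in the F_(i,1). This gives
   phi (Theta_n) = (n+1)! f_(n+1) for every genus phi with exponential f.

   The two exponentials are then expanded up to x^7 from 2 f'' = P' (f), with P
   the radicand, for Bc, and from f = sigma (x) exp (alpha x + k), with
   k'' = wp (z - x), for Kr.

   For the kernel, alpha, wp, wp', g2 can be recovered from the first four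
   values Kr (Theta_i), so there is a ring morphism psi with
   psi (Kr Theta_i) = Theta_i for i <= 4. The only monomials of weight 6
   involving other generators are Theta_6 and Theta_5 Theta_1, which K and L
   eliminate. So every x of weight 6 is c K + d L + y with psi (Kr y) = y, and
   Kr x = 0 forces y = 0. *)

Require Import Defs.
From HB Require Import structures.
From mathcomp Require Import all_boot all_order all_algebra.
From mathcomp Require Import ring zify boolp.
From mathcomp Require Import finmap monalg.

Set Implicit Arguments.
Unset Strict Implicit.
Unset Printing Implicit Defensive.

Import Order.TTheory GRing.Theory Num.Theory.

Local Open Scope ring_scope.

(** * The ring of formal power series *)

(** Coefficient functions get a name of their own, to which the ring structure of the Cauchy product
    is attached; [ring] then applies to series. *)
Definition fps (R : Type) := nat -> R.

Section FpsRing.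
Variable R : comNzRingType.
Implicit Types (f g h : fps R) (k n : nat).

HB.instance Definition _ := gen_eqMixin (fps R).
HB.instance Definition _ := gen_choiceMixin (fps R).

Definition fps_add f g : fps R := fun n => f n + g n.
Definition fps_opp f : fps R := fun n => - f n.
Definition fps_zero : fps R := fun=> 0.

Fact fps_addA : associative fps_add.
Proof. by move=> f g h; apply/funext=> n; apply: addrA. Qed.
Fact fps_addC : commutative fps_add.
Proof. by move=> f g; apply/funext=> n; apply: addrC. Qed.
Fact fps_add0 : left_id fps_zero fps_add.
Proof. by move=> f; apply/funext=> n; apply: add0r. Qed.
Fact fps_addN : left_inverse fps_zero fps_opp fps_add.
Proof. by move=> f; apply/funext=> n; apply: addNr. Qed.
HB.instance Definition _ :=
  GRing.isZmodule.Build (fps R) fps_addA fps_addC fps_add0 fps_addN.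

Let mulfA : associative (@fps_mul R : fps R -> fps R -> fps R).
Proof. by move=> f g h; apply/funext=> n; apply: fps_mulA. Qed.
Let mulfC : commutative (@fps_mul R : fps R -> fps R -> fps R).
Proof. by move=> f g; apply/funext=> n; apply: fps_mulC. Qed.
Let mul1f : left_id (fps_one R : fps R) (@fps_mul R).
Proof. by move=> f; rewrite mulfC; apply/funext=> n; apply: fps_mul1. Qed.
Let mulfDl : left_distributive (@fps_mul R : fps R -> fps R -> fps R) +%R.
Proof.
move=> f g h; apply/funext=> n; rewrite /fps_mul -[RHS]big_split /=.
by apply: eq_bigr => i _; rewrite mulrDl.
Qed.
Let fps_one_neq0 : (fps_one R : fps R) != 0.
Proof.
apply/eqP=> /(congr1 (fun f : fps R => f 0%N))/eqP.
by rewrite /fps_one /= oner_eq0.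
Qed.
HB.instance Definition _ :=
  GRing.Zmodule_isComNzRing.Build (fps R) mulfA mulfC mul1f mulfDl fps_one_neq0.

Lemma fps_addE f g n : (f + g) n = f n + g n. Proof. by []. Qed.
Lemma fps_oppE f n : (- f) n = - f n. Proof. by []. Qed.
Lemma fps_mulE f g : fps_mul f g = f * g. Proof. by []. Qed.
Lemma fps_coefM f g n : (f * g) n = \sum_(i < n.+1) f i * g (n - i)%N.
Proof. by []. Qed.
Lemma fps_mulrn f k n : (f *+ k) n = f n *+ k.
Proof. by elim: k => // k IHk; rewrite !mulrS fps_addE IHk. Qed.
Lemma fps_powE f k : fps_pow f k = f ^+ k.
Proof. by elim: k => // k IHk; rewrite exprS -IHk. Qed.

(** The powers [g ^+ k] with k > n have no term of degree n, so sums for different n can be taken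
    over a common range. *)
Lemma fps_comp_widen f g N n : g 0%N = 0 -> (n < N)%N ->
  fps_comp f g n = \sum_(k < N) f k * (g ^+ k : fps R) n.
Proof.
move=> g0 lt_nN; rewrite /fps_comp.
rewrite (big_ord_widen N (fun k => f k * fps_pow g k n)) // big_mkcond /=.
apply: eq_bigr => k _; rewrite fps_powE; case: ltnP => // lt_nk.
by rewrite -fps_powE fps_pow_lt ?mulr0.
Qed.

(** Both sides expand to the sum of f_i g_j (h^(i+j))_n over i, j <= n. *)
Lemma fps_compM f g h : h 0%N = 0 ->
  fps_comp (f * g) h = (fps_comp f h : fps R) * fps_comp g h.
Proof.
move=> h0; apply/funext=> n; rewrite fps_coefM (@fps_comp_widen _ _ n.+1) //.
have powlt k : (n < k)%N -> (h ^+ k : fps R) n = 0.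
  by move=> lt_nk; rewrite -fps_powE fps_pow_lt.
transitivity (\sum_(i < n.+1) \sum_(j < n.+1) f i * g j * (h ^+ (i + j) : fps R) n).
  (* Here k = i + j. The full square also contains pairs with i + j > n, whose terms vanish because
     h has no constant term. *)
  transitivity (\sum_(i < n.+1) \sum_(k < n.+1 | (i <= k)%N)
                   f i * g (k - i)%N * (h ^+ k : fps R) n).
    rewrite (exchange_big_dep xpredT) //=; apply: eq_bigr => k _.
    rewrite fps_coefM mulr_suml.
    rewrite (big_ord_widen n.+1
      (fun i => f i * g (k - i)%N * (h ^+ k : fps R) n)) //.
  apply: eq_bigr => i _; have le_in : (i <= n)%N by rewrite -ltnS.
  rewrite -(big_mkord (fun k => (i <= k)%N)
    (fun k => f i * g (k - i)%N * (h ^+ k : fps R) n)).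
  rewrite -(big_mkord xpredT (fun j => f i * g j * (h ^+ (i + j) : fps R) n)).
  rewrite (@big_cat_nat _ _ _ i) //=; last exact: leqW.
  rewrite big_nat_cond big1 ?add0r; last first.
    by move=> k /andP[/andP[_ lt_ki]]; rewrite leqNgt lt_ki.
  rewrite [RHS](@big_cat_nat _ _ _ (n.+1 - i)) ?leq_subr //=.
  rewrite [X in _ = _ + X]big_nat_cond [X in _ = _ + X]big1 ?addr0; last first.
    move=> k /andP[/andP[le_k _] _]; rewrite powlt ?mulr0 //; lia.
  rewrite -{1}[i : nat]add0n big_addn big_mkcond /=; apply: eq_bigr => k _.
  by rewrite leq_addl addnK addnC.
under [RHS]eq_bigr => m _.
  rewrite (@fps_comp_widen f h n.+1) // (@fps_comp_widen g h n.+1) //; last first.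
    by rewrite ltnS leq_subr.
  rewrite mulr_suml; under eq_bigr do rewrite mulr_sumr.
  over.
rewrite [RHS]exchange_big /=; apply: eq_bigr => i _.
rewrite [RHS]exchange_big /=; apply: eq_bigr => j _.
rewrite exprD fps_coefM mulr_sumr; apply: eq_bigr => m _.
by rewrite mulrACA.
Qed.

Lemma fps_compD f g h : fps_comp (f + g) h = (fps_comp f h : fps R) + fps_comp g h.
Proof.
apply/funext=> n; rewrite fps_addE -big_split /=.
by apply: eq_bigr => k _; rewrite mulrDl.
Qed.

Lemma fps_comp1 h : fps_comp (1 : fps R) h = (1 : fps R).
Proof.
apply/funext=> n; rewrite /fps_comp big_ord_recl mul1r big1 ?addr0 // => i _.
by rewrite mul0r.
Qed.

Lemma fps_compX h : h 0%N = 0 -> fps_comp (fps_X R) h = h.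
Proof.
move=> h0; apply/funext=> n; rewrite (@fps_comp_widen _ _ n.+2) //.
rewrite !big_ord_recl big1 => [|i _]; last by rewrite /fps_X /= mul0r.
by rewrite /fps_X /= mul0r mul1r add0r addr0 expr1.
Qed.

(** [fps_deriv] with values in [fps R], where the ring operations on series are found. *)
Definition fps_der (f : fps R) : fps R := fps_deriv f.

Lemma fps_derE f n : fps_der f n = f n.+1 *+ n.+1. Proof. by []. Qed.
Lemma fps_derD f g : fps_der (f + g) = fps_der f + fps_der g.
Proof. by apply/funext=> n; rewrite fps_addE !fps_derE fps_addE mulrnDl. Qed.
Lemma fps_derN f : fps_der (- f) = - fps_der f.
Proof. by apply/funext=> n; rewrite fps_oppE !fps_derE fps_oppE mulNrn. Qed.
Lemma fps_derM f g : fps_der (f * g) = fps_der f * g + f * fps_der g.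
Proof. by apply/funext=> n; apply: fps_derivM. Qed.
Lemma fps_der1 : fps_der 1 = 0.
Proof. by apply/funext=> n; rewrite fps_derE mul0rn. Qed.
Lemma fps_der_comp f g : g 0%N = 0 ->
  fps_der (fps_comp f g) = (fps_comp (fps_der f) g : fps R) * fps_der g.
Proof. by move=> g0; apply/funext=> n; apply: fps_deriv_comp. Qed.

(** The n-th derivative at 0. In these coordinates differentiation is a shift and products obey the
    Leibniz rule, so differential equations become recursions without denominators. *)
Definition hcoef f n : R := f n *+ n`!.

Lemma hcoef0 f : hcoef f 0 = f 0%N. Proof. by rewrite /hcoef mulr1n. Qed.
Lemma hcoef_der f n : hcoef (fps_der f) n = hcoef f n.+1.
Proof. by rewrite /hcoef fps_derE -mulrnA factS. Qed.
Lemma hcoefD f g n : hcoef (f + g) n = hcoef f n + hcoef g n.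
Proof. by rewrite /hcoef fps_addE mulrnDl. Qed.
Lemma hcoefN f n : hcoef (- f) n = - hcoef f n.
Proof. by rewrite /hcoef fps_oppE mulNrn. Qed.
Lemma hcoefM f g n :
  hcoef (f * g) n = \sum_(i < n.+1) hcoef f i * hcoef g (n - i) *+ 'C(n, i).
Proof.
rewrite /hcoef fps_coefM -sumrMnl; apply: eq_bigr => i _.
rewrite mulrnAl mulrnAr -!mulrnA; congr (_ *+ _).
by rewrite -(@bin_fact n i) -1?ltnS //; ring.
Qed.

End FpsRing.

(** * Values of a genus on theta divisors *)

Section Genus.

(** The iterates h_k on x of the derivation F_1 d/dx, where F_1 = \sum_i F_(i,1) x^i. *)
Definition fgl_orbit (R : comNzRingType) (F : nat -> nat -> R) : nat -> fps R :=
  fix orb k := if k is m.+1 then fps_der (orb m) * (fun i => F i 1%N) else fps_X R.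

(** The orbit is obtained from the F_(i,1) by ring operations alone. *)
Lemma fgl_orbit_morph (R S : comNzRingType) (phi : {rmorphism R -> S}) F k i :
  phi (fgl_orbit F k i) = fgl_orbit (fun i j => phi (F i j)) k i.
Proof.
elim: k i => [|k IHk] i; first exact: rmorph_nat.
rewrite /= !fps_coefM rmorph_sum; apply: eq_bigr => j _.
by rewrite rmorphM /= !fps_derE rmorphMn /= IHk.
Qed.

(** Since f' = F_1 (f), the derivative of h (f) is (h' F_1) (f). Hence the k-th derivative of f is
    h_k (f), with value h_k (0) at 0. *)
Lemma fgl_orbit_exp (R : comNzRingType) F (f : nat -> R) k :
  is_exponential F f -> fgl_orbit F k 0%N = hcoef f k.
Proof.
case=> f0 f1 expF; rewrite /hcoef -iter_deriv0.
have derf : fps_der f = fps_comp (fun i => F i 1%N) f.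
  (* In the coefficient of x^m y only j = 1 contributes, because (f^0)_1 = 0 and f_1 = 1. *)
  apply/funext=> m; rewrite fps_derE; have := expF m 1%N.
  rewrite addn1 binSn => <-; apply: eq_bigr => i _.
  rewrite !big_ord_recl big_ord0 /= addr0 /fps_one /= mulr0 add0r.
  by rewrite fps_mul1 f1 mulr1.
suff -> : iter k (@fps_deriv R) f = fps_comp (fgl_orbit F k) f.
  by rewrite fps_comp0.
elim: k => [|k IHk] /=; first by rewrite fps_compX.
rewrite fps_compM // -derf -fps_der_comp // -IHk.
by [].
Qed.

(** [FGL_OmegaQ] is built from f = [exp_OmegaU] and f^-1, so its k-th orbit series is f^(k) (f^-1
    x). The constant term f^(k) (0) is Theta_(k-1) by the choice of f. *)
Lemma fgl_orbit_ThetaQ n : fgl_orbit FGL_OmegaQ n.+1 0%N = ThetaQ n.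
Proof.
pose g k := fps_comp (iter k (@fps_deriv OmegaQ) exp_OmegaU) (fps_rev exp_OmegaU).
have orbE k : fgl_orbit FGL_OmegaQ k = g k.
  elim: k => [|k IHk]; apply/funext=> i.
    by rewrite /g /= (@fps_comp_rev OmegaQ exp_OmegaU (erefl _) exp_OmegaU1).
  rewrite /g (@exp_deriv_fgl OmegaQ exp_OmegaU k (erefl _) exp_OmegaU1 i).
  by rewrite /= IHk.
rewrite orbE /g fps_comp0 iter_deriv0 /exp_OmegaU -scaler_nat scalerA.
by rewrite mulfV ?scale1r // pnatr_eq0 -lt0n fact_gt0.
Qed.

Lemma fgl_orbit_Theta n : fgl_orbit FGL_OmegaU n.+1 0%N = Theta n.
Proof.
apply: val_inj; rewrite (fgl_orbit_morph (val : {rmorphism OmegaU -> OmegaQ})).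
exact: fgl_orbit_ThetaQ.
Qed.

(** The constant term of the orbit is Theta_n before [phi] is applied and a derivative of f at 0
    afterwards. *)
Lemma genus_ThetaQ (S : comNzRingType) (phi : {rmorphism OmegaQ -> S}) f n :
    is_exponential (fun i j => phi (FGL_OmegaQ i j)) f ->
  phi (ThetaQ n) = hcoef f n.+1.
Proof. by move/fgl_orbit_exp <-; rewrite -fgl_orbit_morph fgl_orbit_ThetaQ. Qed.

Lemma genus_Theta (S : comNzRingType) (phi : {rmorphism OmegaU -> S}) f n :
    is_exponential (fun i j => phi (FGL_OmegaU i j)) f ->
  phi (Theta n) = hcoef f n.+1.
Proof. by move/fgl_orbit_exp <-; rewrite -fgl_orbit_morph fgl_orbit_Theta. Qed.

End Genus.

(** * Exponentials and powers of series over a Q-algebra *)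

Section RationalFps.
Variable A : comAlgType rat.
Implicit Types (f g h s u v : fps A) (a b : A) (c : rat) (k n : nat).

Lemma mulrSn_inj n : injective (fun a => a *+ n.+1).
Proof.
move=> a b /= /(congr1 (fun x => (n.+1%:R^-1 : rat) *: x)).
by rewrite -!scaler_nat !scalerA mulVf ?pnatr_eq0 // !scale1r.
Qed.

Lemma hcoef_inj f g : (forall n, hcoef f n = hcoef g n) -> f = g.
Proof.
move=> fg; apply/funext=> n; move: (fg n); rewrite /hcoef.
by rewrite -(prednK (fact_gt0 n)) => /mulrSn_inj.
Qed.

Lemma fps_der_inj f g : f 0%N = g 0%N -> fps_der f = fps_der g -> f = g.
Proof.
move=> fg0 fg; apply: hcoef_inj => -[|n]; first by rewrite !hcoef0.
by rewrite -!hcoef_der fg.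
Qed.

Lemma hcoef_ode f v n : fps_der f = f * v ->
  hcoef f n.+1 = \sum_(i < n.+1) hcoef f i * hcoef v (n - i) *+ 'C(n, i).
Proof. by move=> ode; rewrite -hcoef_der ode hcoefM. Qed.

(** The recursion coming from f' = f v determines each derivative at 0 from the earlier ones. *)
Lemma fps_ode_uniq f g v : f 0%N = g 0%N ->
  fps_der f = f * v -> fps_der g = g * v -> f = g.
Proof.
move=> fg0 odef odeg; apply: hcoef_inj => n.
elim/ltn_ind: n => -[|n] IHn; first by rewrite !hcoef0.
rewrite (hcoef_ode n odef) (hcoef_ode n odeg).
by apply: eq_bigr => i _; rewrite IHn.
Qed.

Lemma fps_int0 s : fps_int s 0%N = 0. Proof. by []. Qed.

Lemma hcoef_int s n : hcoef (fps_int s) n.+1 = hcoef s n.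
Proof.
rewrite /hcoef /= factS mulrnA; congr (_ *+ _).
by rewrite -scaler_nat scalerA mulfV ?scale1r ?pnatr_eq0.
Qed.

Lemma fps_der_int s : fps_der (fps_int s) = s.
Proof. by apply: hcoef_inj => n; rewrite hcoef_der hcoef_int. Qed.

Lemma hcoef_linear a n : hcoef (fps_linear a) n = if n == 1%N then a else 0.
Proof. by rewrite /hcoef /fps_linear; case: eqP => [->|]; rewrite ?mul0rn. Qed.

Lemma hcoef_XM f n : hcoef ((fps_X A : fps A) * f) n.+1 = hcoef f n *+ n.+1.
Proof.
rewrite /hcoef fps_coefM !big_ord_recl big1 => [|i _]; last first.
  by rewrite /fps_X /= mul0r.
rewrite /fps_X /= mul0r mul1r add0r addr0 factS mulnC mulrnA.
by rewrite /bump /= subSS subn0.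
Qed.

Lemma fps_exp0 u : fps_exp u 0%N = 1.
Proof. by rewrite /fps_exp fps_comp0 invr1 scale1r. Qed.

Lemma fps_der_exp u : u 0%N = 0 ->
  fps_der (fps_exp u) = (fps_exp u : fps A) * fps_der u.
Proof.
move=> u0; rewrite /fps_exp fps_der_comp //; congr (_ * _); congr fps_comp.
apply/funext=> n; rewrite fps_derE -scaler_nat scalerA; congr (_ *: _).
by rewrite factS natrM invfM mulrA mulfV ?mul1r ?pnatr_eq0.
Qed.

(** Both sides solve f' = f (u + v)' with constant term 1. *)
Lemma fps_expD u v : u 0%N = 0 -> v 0%N = 0 ->
  (fps_exp u : fps A) * fps_exp v = fps_exp (u + v).
Proof.
move=> u0 v0; apply: (@fps_ode_uniq _ _ (fps_der (u + v))).
- by rewrite fps_coefM big_ord1 !fps_exp0 mulr1.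
- by rewrite fps_derM !fps_der_exp // fps_derD; ring.
- by rewrite fps_der_exp // fps_addE u0 v0 addr0.
Qed.

Definition fps_scale c f : fps A := fun n => c *: f n.

Lemma fps_scalerAl c f g : fps_scale c f * g = fps_scale c (f * g).
Proof.
apply/funext=> n; rewrite /fps_scale !fps_coefM scaler_sumr.
by apply: eq_bigr => i _; rewrite scalerAl.
Qed.

Lemma fps_comp_scale c f g : fps_comp (fps_scale c f) g = fps_scale c (fps_comp f g).
Proof.
apply/funext=> n; rewrite /fps_scale scaler_sumr.
by apply: eq_bigr => k _; rewrite -scalerAl.
Qed.

Lemma fps_rpow0 h c : h 0%N = 1 -> fps_rpow h c 0%N = 1.
Proof. by move=> h0; rewrite /fps_rpow fps_comp0 big_ord0 invr1 mulr1 scale1r. Qed.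

(** With b the binomial series, h^c = b (h - 1), and the claim is (1 + x) b' = c b composed with h -
    1. *)
Lemma fps_der_rpow h c : h 0%N = 1 ->
  h * fps_der (fps_rpow h c) = fps_scale c ((fps_rpow h c : fps A) * fps_der h).
Proof.
move=> h0; rewrite /fps_rpow -/(fps_one A).
set b : fps A := fun n => _.
have -> : (fun n => h n - fps_one A n) = h - 1 by [].
have g0 : (h - 1) 0%N = 0 by rewrite fps_addE h0 fps_oppE subrr.
(* The ratio of consecutive binomial coefficients. *)
have bS m : b m.+1 *+ m.+1 = (c - m%:R) *: b m.
  rewrite /b -scaler_nat !scalerA; congr (_ *: _).
  rewrite big_ord_recr /= factS natrM invfM.
  by field; rewrite !pnatr_eq0 -lt0n fact_gt0 addrC natr1 pnatr_eq0.
have hE : h = fps_comp (1 + (fps_X A : fps A)) (h - 1).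
  by rewrite fps_compD fps_comp1 fps_compX // addrC subrK.
rewrite fps_der_comp // {1}hE mulrA -fps_compM // -fps_scalerAl -fps_comp_scale.
rewrite fps_derD fps_derN fps_der1 subr0; congr (_ * _); congr fps_comp.
apply/funext=> n; rewrite mulrDl mul1r fps_addE fps_derE bS /fps_scale.
case: n => [|n]; first by rewrite fps_coefM big_ord1 mul0r addr0 subr0.
have -> : ((fps_X A : fps A) * fps_der b) n.+1 = fps_der b n.
  rewrite fps_coefM !big_ord_recl big1 => [|i _]; last by rewrite /fps_X /= mul0r.
  by rewrite /fps_X /= mul0r mul1r add0r addr0 /bump /= subSS subn0.
by rewrite fps_derE -scaler_nat -scalerDl subrK.
Qed.

Lemma fps_rpowN1 h : h 0%N = 1 -> (fps_rpow h (-1) : fps A) * h = 1.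
Proof.
move=> h0; apply: fps_der_inj.
  by rewrite fps_coefM big_ord1 fps_rpow0 // h0 mulr1.
rewrite fps_derM fps_der1 [_ * h]mulrC fps_der_rpow //.
have -> f : fps_scale (-1) f = - f by apply/funext=> n; apply: scaleN1r.
by rewrite addNr.
Qed.

(** The product s^2 h has constant term 1 and derivative s (2 h s' + s h'), which is zero by the
    equation for s. *)
Lemma fps_rpowN_half h : h 0%N = 1 -> (fps_rpow h (- 2^-1) : fps A) ^+ 2 * h = 1.
Proof.
move=> h0; set s : fps A := fps_rpow h _.
have s0 : s 0%N = 1 by apply: fps_rpow0.
apply: fps_der_inj.
  by rewrite expr2 !fps_coefM !big_ord1 !fps_coefM !big_ord1 s0 h0 !mulr1.
have := fps_der_rpow (- 2^-1) h0; rewrite -/s => ds.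
rewrite fps_der1 expr2 !fps_derM.
have -> : (fps_der s * s + s * fps_der s) * h + s * s * fps_der h =
   s * (h * fps_der s *+ 2 + s * fps_der h) by ring.
rewrite ds; suff -> f : fps_scale (- 2^-1) f *+ 2 = - f by rewrite addNr mulr0.
apply/funext=> n; rewrite fps_mulrn /fps_scale -scaler_nat scalerA.
by rewrite mulrN mulfV ?scaleN1r.
Qed.

(** Both series are inverse to exp u. *)
Lemma fps_rpow_exp u : u 0%N = 0 -> fps_rpow (fps_exp u) (-1) = fps_exp (- u).
Proof.
move=> u0; have u0' : (- u) 0%N = 0 by rewrite fps_oppE u0 oppr0.
have e1 : (fps_exp u : fps A) * fps_exp (- u) = 1.
  rewrite fps_expD // subrr; apply: (@fps_ode_uniq _ _ 0).
  - by rewrite fps_exp0.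
  - rewrite fps_der_exp //; congr (_ * _).
    by apply/funext=> n; rewrite fps_derE mul0rn.
  - by rewrite fps_der1 mulr0.
rewrite -[LHS](@mulr1 (fps A)) -e1 mulrA fps_rpowN1 ?mul1r //.
exact: fps_exp0.
Qed.

End RationalFps.

(** * The Krichever exponential *)

Lemma scalerVnK (V : lmodType rat) n (a : V) : (0 < n)%N ->
  (n%:R^-1 : rat) *: a *+ n = a.
Proof.
by move=> n0; rewrite -scaler_nat scalerA mulfV ?scale1r // pnatr_eq0 -lt0n.
Qed.

Lemma hcoef_const (A : comAlgType rat) (a : A) n :
  hcoef (fps_const a) n = if n is 0 then a else 0.
Proof. by case: n => [|n]; rewrite /hcoef ?mulr1n ?mul0rn. Qed.

(** The equation y'' = 6 y^2 - h of wp, with h = g2 / 2, is read off order by order at 0. *)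
Lemma hcoef_weierstrass (A : comAlgType rat) (h p p' : A) (y : fps A) :
    y 0%N = p -> y 1%N = p' ->
    fps_der (fps_der y) = y * y *+ 6 - (fps_const h : fps A) ->
  [/\ hcoef y 0 = p, hcoef y 1 = p', hcoef y 2 = 6 * p ^+ 2 - h,
      hcoef y 3 = 12 * p * p' & hcoef y 4 = 12 * (p' ^+ 2 + p * (6 * p ^+ 2 - h))].
Proof.
move=> y0 y1 ode.
have h0 : hcoef y 0 = p by rewrite hcoef0.
have h1 : hcoef y 1 = p' by rewrite /hcoef mulr1n.
have rec n : hcoef y n.+2 =
    (\sum_(i < n.+1) hcoef y i * hcoef y (n - i) *+ 'C(n, i)) *+ 6
    - (if n is 0 then h else 0).
  rewrite -!hcoef_der ode hcoefD hcoefN hcoef_const -hcoefM; congr (_ - _).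
  by rewrite /hcoef fps_mulrn mulrnAC.
have h2 : hcoef y 2 = 6 * p ^+ 2 - h.
  by rewrite rec !big_ord_recr big_ord0 /binomial /= h0; ring.
have h3 : hcoef y 3 = 12 * p * p'.
  by rewrite rec !big_ord_recr big_ord0 /binomial /= h0 h1; ring.
split=> //; rewrite rec !big_ord_recr big_ord0 /binomial /= h0 h1 h2; ring.
Qed.

Section KricheverExponential.

Local Notation h2 := ((2^-1 : rat) *: g2).

Lemma g2E : g2 = h2 *+ 2. Proof. by rewrite scalerVnK. Qed.

Lemma size_wp_taylor_seq n : size (wp_taylor_seq n) = n.
Proof. by elim: n => //= n IHn; rewrite size_rcons IHn. Qed.

Lemma nth_wp_taylor_seq n i : (i < n)%N -> (wp_taylor_seq n)`_i = wp_taylor i.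
Proof.
elim: n => // n IHn; rewrite ltnS leq_eqVlt => /predU1P[->//|lt_in].
by rewrite nth_rcons size_wp_taylor_seq lt_in IHn.
Qed.

Lemma wp_taylor_ode :
  fps_der (fps_der wp_taylor) =
    (wp_taylor : fps KrRing) * wp_taylor *+ 6 - (fps_const h2 : fps KrRing).
Proof.
apply/funext=> n; rewrite !fps_derE fps_addE fps_mulrn fps_oppE -mulrnA.
have -> : wp_taylor n.+2 = ((n.+2 * n.+1)%:R^-1 : rat) *:
    (6 * \sum_(i < n.+1) wp_taylor i * wp_taylor (n - i)
     - fps_const h2 n).
  have sumE : \sum_(i < n.+1) (wp_taylor_seq n.+2)`_i * (wp_taylor_seq n.+2)`_(n - i)
      = \sum_(i < n.+1) wp_taylor i * wp_taylor (n - i).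
    by apply: eq_bigr => i _; rewrite !nth_wp_taylor_seq //; have := ltn_ord i; lia.
  rewrite -sumE {1}/wp_taylor.
  (* The branch [m.+2] of the recursion, exposed by conversion. *)
  have -> : wp_taylor_seq n.+3 = rcons (wp_taylor_seq n.+2)
     (((n.+2 * n.+1)%:R^-1 : rat) *:
       (6 * \sum_(i < n.+1) (wp_taylor_seq n.+2)`_i * (wp_taylor_seq n.+2)`_(n - i)
        - fps_const h2 n)) by [].
  by rewrite nth_rcons size_wp_taylor_seq ltnn eqxx.
by rewrite scalerVnK // fps_coefM mulr_natl.
Qed.

Lemma hcoef_wp_taylor :
  [/\ hcoef wp_taylor 0 = wp_z, hcoef wp_taylor 1 = wp'_z,
      hcoef wp_taylor 2 = 6 * wp_z ^+ 2 - h2,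
      hcoef wp_taylor 3 = 12 * wp_z * wp'_z &
      hcoef wp_taylor 4 = 12 * (wp'_z ^+ 2 + wp_z * (6 * wp_z ^+ 2 - h2))].
Proof. by apply: hcoef_weierstrass wp_taylor_ode. Qed.

Lemma wp_regular_values :
  [/\ wp_regular 0 = 0, wp_regular 1 = 0, wp_regular 2 *+ 10 = h2,
      wp_regular 3 = 0 & wp_regular 4 *+ 28 = g3].
Proof.
split=> //.
  rewrite [wp_regular 2]/((20^-1 : rat) *: g2) -scaler_nat scalerA.
  by congr (_ *: _).
by rewrite [wp_regular 4]/((28^-1 : rat) *: g3) scalerVnK.
Qed.

(** For w = wp (x) - x^-2 this is sigma (x) = x - g2 x^5 / 240 - g3 x^7 / 840 + ..., with h = g2 / 2
    and g = g3. The factor e = exp v is expanded from e' = e v'. *)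
Lemma hcoef_sigma (A : comAlgType rat) (h g : A) (w : fps A) :
    w 0%N = 0 -> w 1%N = 0 -> w 2 *+ 10 = h -> w 3 = 0 -> w 4 *+ 28 = g ->
  [seq hcoef ((fps_X A : fps A) * fps_exp (- (fps_int (fps_int w) : fps A))) n
     | n <- iota 1 7] = [:: 1; 0; 0; 0; - h; 0; - (6 * g)].
Proof.
move=> w0 w1 w2 w3 w4; set v : fps A := - _; set e : fps A := fps_exp v.
have v0 : v 0%N = 0 by rewrite /v fps_oppE oppr0.
have hv0 : hcoef v 0 = 0 by rewrite hcoef0.
have hv1 : hcoef v 1 = 0 by rewrite /v hcoefN !hcoef_int hcoef0 fps_int0 oppr0.
have hvE n : hcoef v n.+2 = - (w n *+ n`!) by rewrite /v hcoefN !hcoef_int.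
have rec n := hcoef_ode n (fps_der_exp v0).
have e0 : hcoef e 0 = 1 by rewrite hcoef0 /e fps_exp0.
have dv n : hcoef (fps_der v) n = hcoef v n.+1 by apply: hcoef_der.
have hv : [/\ hcoef v 2 = 0, hcoef v 3 = 0, hcoef v 4 = - (w 2 *+ 2), hcoef v 5 = 0
            & hcoef v 6 = - (w 4 *+ 24)].
  by rewrite !hvE w0 w1 w3 !mul0rn !oppr0.
case: hv => hv2 hv3 hv4 hv5 hv6; rewrite -/e in rec.
have e1 : hcoef e 1 = 0.
  by rewrite rec !big_ord_recr big_ord0 /binomial /= !dv e0 hv1; ring.
have e2 : hcoef e 2 = 0.
  by rewrite rec !big_ord_recr big_ord0 /binomial /= !dv e0 e1 hv1 hv2; ring.
have e3 : hcoef e 3 = 0.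
  by rewrite rec !big_ord_recr big_ord0 /binomial /= !dv e0 e1 e2 hv1 hv2 hv3; ring.
have e4 : hcoef e 4 = - (w 2 *+ 2).
  rewrite rec !big_ord_recr big_ord0 /binomial /= !dv.
  by rewrite e0 e1 e2 e3 hv1 hv2 hv3 hv4; ring.
have e5 : hcoef e 5 = 0.
  rewrite rec !big_ord_recr big_ord0 /binomial /= !dv.
  by rewrite e0 e1 e2 e3 e4 hv1 hv2 hv3 hv4 hv5; ring.
have e6 : hcoef e 6 = - (w 4 *+ 24).
  rewrite rec !big_ord_recr big_ord0 /binomial /= !dv.
  by rewrite e0 e1 e2 e3 e4 e5 hv1 hv2 hv3 hv4 hv5 hv6; ring.
rewrite /= !hcoef_XM e0 e1 e2 e3 e4 e5 e6 -w2 -w4.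
by do !congr (_ :: _); ring.
Qed.

(* Kr (Theta_1), ..., Kr (Theta_6), for h = g2 / 2 (so that all coefficients
   are integral) and g = g3. Here e_n is the n-th derivative at x = 0 of
   exp (alpha x + k), with k'' = wp (z - x), and k_n is wp^(n-1) (z). *)
Definition Kr_Theta (A : comNzRingType) (al p p' h g : A) : seq A :=
  let k3 := 6 * p ^+ 2 - h in
  let k4 := 12 * p * p' in
  let k5 := 12 * (p' ^+ 2 + p * (6 * p ^+ 2 - h)) in
  let e2 := al ^+ 2 + p in
  let e3 := al ^+ 3 + 3 * al * p - p' in
  let e4 := al * e3 + 3 * p * e2 - 3 * p' * al + k3 in
  let e5 := al * e4 + 4 * p * e3 - 6 * p' * e2 + 4 * k3 * al - k4 in
  let e6 := al * e5 + 5 * p * e4 - 10 * p' * e3 + 10 * k3 * e2 - 5 * k4 * al + k5 in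
  [:: 2 * al; 3 * e2; 4 * e3; 5 * e4 - h; 6 * e5 - 6 * h * al;
      7 * e6 - 21 * h * e2 - 6 * g].

(** In the application s is sigma and u = alpha x + k. Orders 2 to 7 correspond to Theta_1, ...,
    Theta_6. *)
Lemma hcoef_Kr_generic (A : comAlgType rat) (al p p' h g : A) (s u : fps A) :
    s 0%N = 0 -> u 0%N = 0 ->
    [seq hcoef s n | n <- iota 1 7] = [:: 1; 0; 0; 0; - h; 0; - (6 * g)] ->
    [seq hcoef u n | n <- iota 1 6] =
      [:: al; p; - p'; 6 * p ^+ 2 - h; - (12 * p * p');
          12 * (p' ^+ 2 + p * (6 * p ^+ 2 - h))] ->
  [seq hcoef (s * fps_exp u) n | n <- iota 2 6] = Kr_Theta al p p' h g.
Proof.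
move=> s0 u0 [s1 s2 s3 s4 s5 s6 s7] [u1 u2 u3 u4 u5 u6].
set e : fps A := fps_exp u.
have hs0 : hcoef s 0 = 0 by rewrite hcoef0.
have rec n : hcoef e n.+1 =
    \sum_(i < n.+1) hcoef e i * hcoef u (n - i).+1 *+ 'C(n, i).
  rewrite (hcoef_ode n (fps_der_exp u0)).
  by apply: eq_bigr => i _; rewrite hcoef_der.
have e0 : hcoef e 0 = 1 by rewrite hcoef0 /e fps_exp0.
have e1 : hcoef e 1 = al.
  by rewrite rec !big_ord_recr big_ord0 /binomial /= e0 u1; ring.
have e2 : hcoef e 2 = al ^+ 2 + p.
  by rewrite rec !big_ord_recr big_ord0 /binomial /= e0 e1 u1 u2; ring.
have e3 : hcoef e 3 = al ^+ 3 + 3 * al * p - p'.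
  by rewrite rec !big_ord_recr big_ord0 /binomial /= e0 e1 e2 u1 u2 u3; ring.
(* From order 4 on the recursion is kept unevaluated, in the shape used by [Kr_Theta]. *)
have e4 := rec 3%N; rewrite !big_ord_recr big_ord0 /binomial /= in e4.
have e5 := rec 4%N; rewrite !big_ord_recr big_ord0 /binomial /= in e5.
have e6 := rec 5%N; rewrite !big_ord_recr big_ord0 /binomial /= in e6.
rewrite /= !hcoefM !big_ord_recr !big_ord0 /binomial /=.
rewrite hs0 s1 s2 s3 s4 s5 s6 s7 e6 e5 e4 e0 e1 e2 e3 u1 u2 u3 u4 u5 u6.
by rewrite /Kr_Theta; do !congr (_ :: _); ring.
Qed.

(** Dividing by exp (- k) multiplies by exp k, and the two exponentials merge. *)
Lemma fps_exp_quotient (A : comAlgType rat) (s l k : fps A) :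
    l 0%N = 0 -> k 0%N = 0 ->
  fps_mul (fps_exp l) (fps_mul s (fps_rpow (fps_exp (- k)) (-1))) =
  s * fps_exp (l + k).
Proof.
move=> l0 k0; have nk0 : (- k) 0%N = 0 by rewrite fps_oppE k0 oppr0.
by rewrite fps_rpow_exp // opprK -fps_expD // !fps_mulE mulrCA.
Qed.

Lemma hcoef_Kr :
  [seq hcoef Kr_exp n | n <- iota 2 6] = Kr_Theta Kr_alpha wp_z wp'_z h2 g3.
Proof.
(* t expands wp (z - x) in x and k is its double primitive, so [sigma_shift] is exp (- k). *)
pose t : fps KrRing := fun m => (-1) ^+ m * wp_taylor m.
pose k : fps KrRing := fps_int (fps_int t).
pose l : fps KrRing := fps_linear Kr_alpha.
have l0 : l 0%N = 0 by [].
have k0 : k 0%N = 0 by [].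
have -> : Kr_exp = (sigma_series : fps KrRing) * fps_exp (l + k).
  exact: fps_exp_quotient.
apply: hcoef_Kr_generic.
- by rewrite /sigma_series fps_mulE fps_coefM big_ord1 mul0r.
- by rewrite fps_addE l0 add0r.
- case: wp_regular_values => *; exact: hcoef_sigma.
have lk n : hcoef (l + k) n.+2 =
    if odd n then - hcoef wp_taylor n else hcoef wp_taylor n.
  rewrite hcoefD hcoef_linear !hcoef_int add0r -mulr_sign signr_odd.
  by rewrite /hcoef mulrnAr.
have lk1 : hcoef (l + k) 1 = Kr_alpha.
  by rewrite hcoefD hcoef_linear hcoef_int hcoef0 addr0.
case: hcoef_wp_taylor => t0 t1 t2 t3 t4.
by rewrite /= lk1 !lk [odd _]/= t0 t1 t2 t3 t4.
Qed.

End KricheverExponential.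

(** * The Buchstaber exponential *)

Section BuchstaberExponential.
Variables (A : comAlgType rat) (b1 b2 b3 : A).

(** The radicand with coefficients in an arbitrary rational algebra; [Bc_exp] is the instance given
    by a_1, a_2, a_3. *)
Let P : fps A := fun n =>
  match n with 0 => 1 | 2 => - b1 | 4 => b2 | 6 => - b3 | _ => 0 end.
Let s : fps A := fps_rpow P (- 2^-1).
Let f : fps A := fps_rev (fps_int s).

(** Since f inverts the integral of s = P^(-1/2), s (f) f' = 1 and so f'^2 = P (f). Differentiating
    gives the equation up to a factor f'. *)
Lemma fps_inverse_integral_ode : fps_der (fps_der f) *+ 2 = fps_comp (fps_der P) f.
Proof.
have f0 : f 0%N = 0 by apply: fps_rev0.
have s0 : s 0%N = 1 by apply: fps_rpow0.
pose S : fps A := fps_comp s f; pose Q : fps A := fps_comp P f.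
have intf : fps_comp (fps_int s) f = fps_X A.
  by apply/funext=> n; apply: fps_comp_rev; rewrite //= s0 invr1 scale1r.
have Sf' : S * fps_der f = 1.
  rewrite /S -[in LHS](fps_der_int s) -fps_der_comp // intf.
  by apply/funext=> -[|n]; rewrite fps_derE /fps_X //= mul0rn.
have SQ : S ^+ 2 * Q = 1.
  have -> : S ^+ 2 = fps_comp (s ^+ 2) f by rewrite !expr2 [RHS]fps_compM.
  by rewrite -(fps_compM _ P f0) fps_rpowN_half // fps_comp1.
have Qf' : Q = fps_der f ^+ 2.
  have -> : Q = (S ^+ 2 * Q) * fps_der f ^+ 2.
    by rewrite mulrAC -exprMn Sf' expr1n mul1r.
  by rewrite SQ mul1r.
have := congr1 (@fps_der A) Qf'; rewrite {1}/Q fps_der_comp // expr2 fps_derM.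
(* S = s (f) is inverse to f' and cancels that factor. *)
move/(congr1 (fun u => S * u)).
rewrite [S * (_ * _)]mulrCA Sf' mulr1 => ->.
rewrite mulrDr [fps_der (fps_der f) * _]mulrC !mulrA Sf' mul1r.
by rewrite mulr2n.
Qed.

(** P' has terms of degree 1, 3 and 5 only, so the recursion for f needs just the derivatives at 0
    of f, f^3 and f^5; f^2 is an auxiliary. *)
Lemma hcoef_Bc_generic :
  [seq hcoef f n | n <- iota 2 6] =
    [:: 0; - b1; 0; b1 ^+ 2 + 12 * b2; 0;
        - b1 ^+ 3 - 132 * b1 * b2 - 360 * b3].
Proof.
have h0 : hcoef f 0 = 0 by rewrite hcoef0; apply: fps_rev0.
have h1 : hcoef f 1 = 1 by apply: fps_rev1.
have rec n : hcoef f n.+2 *+ 2 = \sum_(k < n.+1) fps_der P k * hcoef (f ^+ k) n.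
  have := congr1 (fun u : fps A => hcoef u n) fps_inverse_integral_ode.
  rewrite -!hcoef_der /hcoef fps_mulrn mulrnAC => ->; rewrite -sumrMnl.
  by apply: eq_bigr => k _; rewrite mulrnAr fps_powE.
have cancel2 (x y : A) : x *+ 2 = y *+ 2 -> x = y by apply: mulrSn_inj.
have P1 : fps_der P 1 = - b1 *+ 2 by [].
have P3 : fps_der P 3 = b2 *+ 4 by [].
have P5 : fps_der P 5 = - b3 *+ 6 by [].
have P024 : [/\ fps_der P 0 = 0, fps_der P 2 = 0 & fps_der P 4 = 0].
  by rewrite !fps_derE !mul0rn.
case: P024 => P0 P2 P4.
have h2 : hcoef f 2 = 0.
  by apply: cancel2; rewrite rec big_ord1 P0 mul0r mul0rn.
have h3 : hcoef f 3 = - b1.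
  apply: cancel2; rewrite rec !big_ord_recr big_ord0 /= P0 P1 expr1 h1; ring.
have h4 : hcoef f 4 = 0.
  apply: cancel2; rewrite rec !big_ord_recr big_ord0 /= P0 P1 P2 expr1 h2; ring.
have sq n : hcoef (f ^+ 2) n =
    \sum_(i < n.+1) hcoef f i * hcoef f (n - i) *+ 'C(n, i) by rewrite expr2 hcoefM.
have cub n : hcoef (f ^+ 3) n =
    \sum_(i < n.+1) hcoef f i * hcoef (f ^+ 2) (n - i) *+ 'C(n, i).
  by rewrite exprS hcoefM.
have sq0 : hcoef (f ^+ 2) 0 = 0.
  by rewrite sq big_ord1 h0; ring.
have sq1 : hcoef (f ^+ 2) 1 = 0.
  by rewrite sq !big_ord_recr big_ord0 /binomial /= h0; ring.
have sq2 : hcoef (f ^+ 2) 2 = 2.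
  by rewrite sq !big_ord_recr big_ord0 /binomial /= h0 h1; ring.
have sq3 : hcoef (f ^+ 2) 3 = 0.
  by rewrite sq !big_ord_recr big_ord0 /binomial /= h0 h1 h2; ring.
have sq4 : hcoef (f ^+ 2) 4 = - 8 * b1.
  by rewrite sq !big_ord_recr big_ord0 /binomial /= h0 h1 h2 h3; ring.
have cub0 : hcoef (f ^+ 3) 0 = 0.
  by rewrite cub big_ord1 h0; ring.
have cub1 : hcoef (f ^+ 3) 1 = 0.
  by rewrite cub !big_ord_recr big_ord0 /binomial /= h0 sq0; ring.
have cub2 : hcoef (f ^+ 3) 2 = 0.
  by rewrite cub !big_ord_recr big_ord0 /binomial /= h0 sq0 sq1; ring.
have cub3 : hcoef (f ^+ 3) 3 = 6.
  by rewrite cub !big_ord_recr big_ord0 /binomial /= h0 h1 sq0 sq1 sq2; ring.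
have cub4 : hcoef (f ^+ 3) 4 = 0.
  rewrite cub !big_ord_recr big_ord0 /binomial /= h0 h1 h2.
  by rewrite sq0 sq1 sq2 sq3; ring.
have cub5 : hcoef (f ^+ 3) 5 = - 60 * b1.
  rewrite cub !big_ord_recr big_ord0 /binomial /= h0 h1 h2 h3 h4.
  by rewrite sq0 sq1 sq2 sq3 sq4; ring.
have quint5 : hcoef (f ^+ 5) 5 = 120.
  rewrite (exprD f 3 2) hcoefM !big_ord_recr big_ord0 /binomial /=.
  by rewrite cub0 cub1 cub2 cub3 cub4 sq0 sq1 sq2; ring.
have h5 : hcoef f 5 = b1 ^+ 2 + 12 * b2.
  apply: cancel2; rewrite rec !big_ord_recr big_ord0 /=.
  by rewrite P0 P1 P2 P3 expr1 h3 cub3; ring.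
have h6 : hcoef f 6 = 0.
  apply: cancel2; rewrite rec !big_ord_recr big_ord0 /=.
  by rewrite P0 P1 P2 P3 P4 expr1 h4 cub4; ring.
have h7 : hcoef f 7 = - b1 ^+ 3 - 132 * b1 * b2 - 360 * b3.
  apply: cancel2; rewrite rec !big_ord_recr big_ord0 /=.
  by rewrite P0 P1 P2 P3 P4 P5 expr1 h5 cub5 quint5; ring.
by rewrite /= h2 h3 h4 h5 h6 h7.
Qed.

End BuchstaberExponential.

Lemma hcoef_Bc :
  [seq hcoef Bc_exp n | n <- iota 2 6] =
    [:: 0; - a1 rat; 0; a1 rat ^+ 2 + 12 * a2 rat; 0;
        - a1 rat ^+ 3 - 132 * a1 rat * a2 rat - 360 * a3 rat].
Proof. exact: hcoef_Bc_generic. Qed.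

(** * Evaluation of polynomials *)

Section MalgMorphisms.

Definition cm_eval (I : choiceType) (S : comNzRingType) (t : I -> S)
  (m : {cmonom I}) : S := \prod_(i <- finsupp m) t i ^+ m i.

Lemma cm_evalEw (I : choiceType) (S : comNzRingType) (t : I -> S)
    (d : {fset I}) (m : {cmonom I}) :
  (finsupp m `<=` d)%fset -> cm_eval t m = \prod_(i <- d) t i ^+ m i.
Proof.
move=> le; rewrite /cm_eval (big_fset_incl _ le) // => i _.
by rewrite -cmE_neq0 negbK => /eqP ->.
Qed.

Fact cm_eval_morphism (I : choiceType) (S : comNzRingType) (t : I -> S) :
  mmorphism (cm_eval t).
Proof.
split=> [m1 m2|]; last by rewrite /cm_eval mdom1 big_seq_fset0.
rewrite {1}/cm_eval mdomD (cm_evalEw t (fsubsetUl _ (finsupp m2))).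
rewrite (cm_evalEw t (fsubsetUr (finsupp m1) _)) -big_split /=.
by apply: eq_bigr => i _; rewrite cmM exprD.
Qed.
HB.instance Definition _ (I : choiceType) (S : comNzRingType) (t : I -> S) :=
  monalg.isMultiplicative.Build {cmonom I} S (cm_eval t) (cm_eval_morphism t).

Lemma cm_evalU (I : choiceType) (S : comNzRingType) (t : I -> S) i :
  cm_eval t (ucm i) = t i.
Proof. by rewrite /cm_eval mdomU big_seq_fset1 cmUU expr1. Qed.

Definition malg_eval (I : choiceType) (S : comAlgType rat) (t : I -> S) :
    {rmorphism {malg rat[{cmonom I}]} -> S} :=
  mmap (in_alg S) (cm_eval t).

Lemma malg_evalU (I : choiceType) (S : comAlgType rat) (t : I -> S) i :
  malg_eval t (mkmalgU (ucm i) 1) = t i.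
Proof. by rewrite /malg_eval /= mmapU /= scale1r mul1r cm_evalU. Qed.

(** Named so that its multiplicativity can be registered, which makes [map_malg] a ring morphism. *)
Definition malg_mon (M : monomType) (R : comNzRingType) (m : M) : {malg R[M]} :=
  mkmalgU m 1.

Lemma malg_monM (M : monomType) (R : comNzRingType) (m1 m2 : M) :
  malg_mon R (mmul m1 m2) = malg_mon R m1 * malg_mon R m2.
Proof. by rewrite malgM_def /malg_mon fgmulUU mulr1. Qed.

Fact malg_mon_morphism (M : monomType) (R : comNzRingType) :
  mmorphism (@malg_mon M R).
Proof. by split=> [m1 m2|//]; apply: malg_monM. Qed.

End MalgMorphisms.

HB.instance Definition _ (M : conomType) (R : comNzRingType) :=
  monalg.isMultiplicative.Build M {malg R[M]} (@malg_mon M R)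
    (@malg_mon_morphism M R).

Section MapMalg.
Variables (M : conomType) (R S : comNzRingType) (f : {rmorphism R -> S}).

Definition map_malg_rmorphism : {rmorphism {malg R[M]} -> {malg S[M]}} :=
  mmap (@malgC M S \o f) (@malg_mon M S).

Lemma map_malgE g : map_malg f g = map_malg_rmorphism g. Proof. by []. Qed.

Lemma mcoeff_map_malg (g : {malg R[M]}) m : (map_malg f g)@_m = f g@_m.
Proof.
transitivity ((map_malg_rmorphism (\sum_(k <- msupp g) mkmalgU k g@_k))@_m).
  by rewrite -monalgE.
transitivity (f (\sum_(k <- msupp g) mkmalgU k g@_k)@_m); last by rewrite -monalgE.
rewrite [map_malg_rmorphism _]raddf_sum ![(\sum_(_ <- _) _)@_m]raddf_sum.
rewrite [RHS]raddf_sum; apply: eq_bigr => k _ /=; rewrite mmapU /malg_mon mul_malgC.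
by rewrite mcoeffZ !mcoeffU rmorphMn /= mulr_natr.
Qed.

(** This lets an identity over Z[1/2] be checked over the rationals. *)
Lemma map_malg_inj : injective f ->
  injective (map_malg f : {malg R[M]} -> {malg S[M]}).
Proof.
move=> f_inj g1 g2 eq_g; apply/malgP => m; apply: f_inj.
by rewrite -!mcoeff_map_malg eq_g.
Qed.

Lemma map_malgU (m : M) : map_malg f (mkmalgU m 1) = mkmalgU m 1.
Proof. by rewrite map_malgE /= mmapU /= rmorph1 mpolyC1E mul1r. Qed.

End MapMalg.

(** * Degrees in the cobordism ring *)

Section ThetaWeight.
Implicit Types (m : {cmonom nat}) (x y : OmegaQ).

Lemma theta_weightEw m (d : {fset nat}) : (finsupp m `<=` d)%fset ->
  theta_weight m = (\sum_(i <- d) m i * i.+1)%N.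
Proof.
move=> le; rewrite /theta_weight (big_fset_incl _ le) // => i _.
by rewrite -cmE_neq0 negbK => /eqP ->.
Qed.

Lemma theta_weight1 : theta_weight mone = 0%N.
Proof. by rewrite /theta_weight mdom1 big_seq_fset0. Qed.

Lemma theta_weightU i : theta_weight (ucm i) = i.+1.
Proof. by rewrite /theta_weight mdomU big_seq_fset1 cmUU mul1n. Qed.

Lemma theta_weightM m1 m2 :
  theta_weight (mmul m1 m2) = (theta_weight m1 + theta_weight m2)%N.
Proof.
rewrite {1}/theta_weight mdomD (theta_weightEw (fsubsetUl _ (finsupp m2))).
rewrite (theta_weightEw (fsubsetUr (finsupp m1) _)) -big_split /=.
by apply: eq_bigr => i _; rewrite cmM mulnDl.
Qed.

Lemma cmonom_factor m i : (0 < m i)%N -> exists m', m = mmul (ucm i) m'.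
Proof.
move=> mi; exists (divcm m (ucm i)); apply/eqP/cmP => j.
rewrite cmM divcmE cmU; case: eqP => [<-|_] /=; first by rewrite add1n subn1 prednK.
by rewrite add0n subn0.
Qed.

Lemma theta_weight_ge m i : (0 < m i)%N -> (i < theta_weight m)%N.
Proof.
case/cmonom_factor=> m' ->.
by rewrite theta_weightM theta_weightU addSn ltnS leq_addr.
Qed.

Lemma theta_weight_eq0 m : theta_weight m = 0%N -> m = mone.
Proof.
move=> m0; apply/eqP/cmP => i; rewrite cm1; apply/eqP.
by rewrite -leqn0 leqNgt; apply/negP => /theta_weight_ge; rewrite m0.
Qed.

Lemma theta_weight_eq1 m : theta_weight m = 1%N -> m = ucm 0.
Proof.
move=> m1; have [/eqP m_one|] := boolP (m == mone).
  by rewrite m_one theta_weight1 in m1.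
case/cmP/existsNP => i; rewrite cm1 => /eqP; rewrite -lt0n => mi.
have [m' m_eq] := cmonom_factor mi.
move: m1; rewrite m_eq theta_weightM theta_weightU addSn => -[/eqP].
rewrite addn_eq0 => /andP[/eqP -> /eqP/theta_weight_eq0 ->].
exact: mulm1.
Qed.

Lemma mkmalgU_factor i m :
  mkmalgU (mmul (ucm i) m) 1 = ThetaQ i.+1 * mkmalgU m 1 :> OmegaQ.
Proof. exact: malg_monM. Qed.

Lemma rmorph_fixM (R : comNzRingType) (f : {rmorphism R -> R}) (a b : R) :
  f a = a -> f b = b -> f (a * b) = a * b.
Proof. by move=> fa fb; rewrite rmorphM fa fb. Qed.

(** Induction on the weight, splitting off one variable at a time; the variable of index i is
    Theta_(i+1). *)
Lemma fixed_by_thetas (s : {rmorphism OmegaQ -> OmegaQ}) (n : nat) m :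
    (forall i, (i < n)%N -> s (ThetaQ i.+1) = ThetaQ i.+1) ->
    (forall i, (0 < m i)%N -> (i < n)%N) ->
  s (mkmalgU m 1) = mkmalgU m 1.
Proof.
move=> s_fix; have [w] := ubnP (theta_weight m).
elim: w m => // w IHw m lt_mw m_supp.
have [/eqP ->|] := boolP (m == mone); first exact: rmorph1.
case/cmP/existsNP => i; rewrite cm1 => /eqP; rewrite -lt0n => mi.
have [m' m_eq] := cmonom_factor mi.
have s_i : s (ThetaQ i.+1) = ThetaQ i.+1 by apply/s_fix/m_supp.
have s_m' : s (mkmalgU m' 1) = mkmalgU m' 1.
  apply: IHw => [|j m'j].
    by move: lt_mw; rewrite m_eq theta_weightM theta_weightU; lia.
  by apply: m_supp; rewrite m_eq cmM addn_gt0 m'j orbT.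
rewrite m_eq (mkmalgU_factor i m').
have := @rmorph_fixM OmegaQ s (ThetaQ i.+1) (mkmalgU m' 1) s_i s_m'.
exact.
Qed.

Lemma in_degreeQU m (c : rat) : in_degreeQ (theta_weight m) (mkmalgU m c).
Proof. by move=> m' /(fsubsetP msuppU_le); rewrite in_fset1 => /eqP ->. Qed.

Lemma in_degreeQ1 : in_degreeQ 0 1.
Proof. by rewrite -theta_weight1; apply: in_degreeQU. Qed.

Lemma in_degreeQ_nat k : in_degreeQ 0 k%:R.
Proof. by move=> m /(fsubsetP (msuppMn_le _ _))/in_degreeQ1. Qed.

Lemma in_degreeQ_Theta n : in_degreeQ n (ThetaQ n).
Proof.
case: n => [|n]; first exact: in_degreeQ1.
by have := @in_degreeQU (ucm n) 1; rewrite theta_weightU.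
Qed.

Lemma in_degreeQD n x y : in_degreeQ n x -> in_degreeQ n y -> in_degreeQ n (x + y).
Proof.
by move=> xn yn m /(fsubsetP (msuppD_le _ _)); rewrite in_fsetU => /orP[/xn|/yn].
Qed.

Lemma in_degreeQB n x y : in_degreeQ n x -> in_degreeQ n y -> in_degreeQ n (x - y).
Proof. by move=> xn yn; apply: in_degreeQD => // m; rewrite msuppN => /yn. Qed.

Lemma in_degreeQZ n (c : rat) x : in_degreeQ n x -> in_degreeQ n (c *: x).
Proof. by move=> xn m /(fsubsetP (msuppZ_le _ _))/xn. Qed.

Lemma in_degreeQM n1 n2 x y :
  in_degreeQ n1 x -> in_degreeQ n2 y -> in_degreeQ (n1 + n2) (x * y).
Proof.
by move=> xn yn m /msuppM_le[m1 [m2 [/xn <- /yn <- ->]]]; apply: theta_weightM.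
Qed.

Lemma in_degreeQX n k x : in_degreeQ n x -> in_degreeQ (k * n) (x ^+ k).
Proof.
move=> xn; elim: k => [|k IHk]; first exact: in_degreeQ1.
by rewrite exprS mulSn; apply: in_degreeQM.
Qed.

End ThetaWeight.

(** * The classes K and L *)

Section Classes.
Variable R : comNzRingType.
Implicit Types t : R.

(** K as a polynomial over any commutative ring, so that it can be carried along ring morphisms and
    handled by [ring]. *)
Definition K_poly t1 t2 t3 t4 t6 : R :=
  t6 + 9 * t1 ^+ 6 - 15 * t1 ^+ 4 * t2 - 3 * t1 ^+ 3 * t3 - 13 * t1 ^+ 2 * t2 ^+ 2
  + 3 * t1 ^+ 2 * t4 + 29 * t1 * t2 * t3 + 10 * t2 ^+ 3 - 11 * t2 * t4
  - 10 * t3 ^+ 2.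

Definition L_poly t1 t2 t3 t4 t5 : R :=
  t5 * t1 - 3 * t4 * t1 ^+ 2 - 11 * t3 * t2 * t1 + 12 * t3 * t1 ^+ 3
  + 22 * t2 ^+ 2 * t1 ^+ 2 - 30 * t2 * t1 ^+ 4 + 9 * t1 ^+ 6.

(** t6 occurs linearly with coefficient 1, so K eliminates it in favour of a polynomial in t1, ...,
    t4. *)
Lemma K_poly_split t1 t2 t3 t4 t6 :
  t6 = K_poly t1 t2 t3 t4 t6 - K_poly t1 t2 t3 t4 0.
Proof. by rewrite /K_poly; ring. Qed.

Lemma L_poly_split t1 t2 t3 t4 t5 :
  t5 * t1 = L_poly t1 t2 t3 t4 t5 - L_poly t1 t2 t3 t4 0.
Proof. by rewrite /L_poly; ring. Qed.

(** The condition on g is the Weierstrass equation with g2 = 2 h. After substitution both claims are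
    polynomial identities in al, p, p', h. *)
Lemma Kr_Theta_relations (al p p' h g : R) t1 t2 t3 t4 t5 t6 :
    [:: t1; t2; t3; t4; t5; t6] = Kr_Theta al p p' h g ->
    g = 4 * p ^+ 3 - h *+ 2 * p - p' ^+ 2 ->
  K_poly t1 t2 t3 t4 t6 = 0 /\ L_poly t1 t2 t3 t4 t5 = 0.
Proof.
move=> [-> -> -> -> -> ->] ->; rewrite /K_poly /L_poly.
by split; ring.
Qed.

End Classes.

Lemma rmorph_K_poly (R S : comNzRingType) (f : {rmorphism R -> S}) t1 t2 t3 t4 t6 :
  f (K_poly t1 t2 t3 t4 t6) = K_poly (f t1) (f t2) (f t3) (f t4) (f t6).
Proof. by rewrite /K_poly; ring. Qed.

Lemma rmorph_L_poly (R S : comNzRingType) (f : {rmorphism R -> S}) t1 t2 t3 t4 t5 :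
  f (L_poly t1 t2 t3 t4 t5) = L_poly (f t1) (f t2) (f t3) (f t4) (f t5).
Proof. by rewrite /L_poly; ring. Qed.

Lemma rmorph_Kr_Theta (R S : comNzRingType) (f : {rmorphism R -> S}) al p p' h g :
  map f (Kr_Theta al p p' h g) = Kr_Theta (f al) (f p) (f p') (f h) (f g).
Proof.
by rewrite /Kr_Theta /=; do !congr (_ :: _); ring.
Qed.

(** The first four entries are triangular: they are 2 al, then 3 p, - 4 p' and - 6 h, each of these
    three plus a polynomial in the preceding unknowns. They are solved by successive division. *)
Lemma Kr_Theta_onto (A : comAlgType rat) (t1 t2 t3 t4 : A) :
  exists al p p' h, forall g,
    take 4 (Kr_Theta al p p' h g) = [:: t1; t2; t3; t4].
Proof.
have half (n : nat) (t : A) : (0 < n)%N -> exists u : A, n%:R * u = t.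
  by move=> n0; exists ((n%:R^-1 : rat) *: t); rewrite mulr_natl scalerVnK.
have [al al_eq] := half 2 t1 isT.
have [p p_eq] := half 3 (t2 - 3 * al ^+ 2) isT.
have [p' p'_eq] := half 4 (4 * (al ^+ 3 + 3 * al * p) - t3) isT.
(* The coefficient - 6 of h collects - 5 from 5 e4, through k3 = 6 p^2 - h, and the explicit - h. *)
have [h h_eq] := half 6 (5 * (al * (al ^+ 3 + 3 * al * p - p')
  + 3 * p * (al ^+ 2 + p) - 3 * p' * al + 6 * p ^+ 2) - t4) isT.
exists al, p, p', h => g; rewrite /Kr_Theta /= al_eq.
have -> : t2 = 3 * p + 3 * al ^+ 2 by rewrite p_eq subrK.
have -> : t3 = 4 * (al ^+ 3 + 3 * al * p) - 4 * p' by rewrite p'_eq; ring.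
set c4 := (X in 6 * h = X - t4) in h_eq.
have -> : t4 = c4 - 6 * h by rewrite h_eq; ring.
by rewrite /c4; do !congr (_ :: _); ring.
Qed.

Section FixedModuloSpan.
Variables (V : lmodType rat) (s : {additive V -> V}) (u v : V).

(** x lies in the sum of the fixed space of s and the span of u and v. *)
Definition fixed_modulo_span (x : V) : Prop :=
  exists c d : rat, s (x - (c *: u + d *: v)) = x - (c *: u + d *: v).

Lemma fixed_modulo_span_sum (I : eqType) (r : seq I) (a : I -> rat) (x : I -> V) :
    (forall i, i \in r -> fixed_modulo_span (x i)) ->
  fixed_modulo_span (\sum_(i <- r) a i *: x i).
Proof.
(* An additive map between rational vector spaces is linear. *)
have sZ : scalable s by apply/rat_linear/raddfB.
move=> x_fix; rewrite big_seq; elim/big_ind: _.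
- by exists 0, 0; rewrite !scale0r addr0 subr0 raddf0.
- move=> y z [c [d y_fix]] [c' [d' z_fix]]; exists (c + c'), (d + d').
  have -> : y + z - ((c + c') *: u + (d + d') *: v) =
      (y - (c *: u + d *: v)) + (z - (c' *: u + d' *: v)).
    by rewrite !scalerDl [X in _ - X]addrACA opprD addrACA.
  by rewrite raddfD y_fix z_fix.
move=> i /x_fix[c [d i_fix]]; exists (a i * c), (a i * d).
by rewrite -!scalerA -scalerDr -scalerBr sZ i_fix.
Qed.

End FixedModuloSpan.

Definition KQ : OmegaQ :=
  K_poly (ThetaQ 1) (ThetaQ 2) (ThetaQ 3) (ThetaQ 4) (ThetaQ 6).
Definition LQ : OmegaQ :=
  L_poly (ThetaQ 1) (ThetaQ 2) (ThetaQ 3) (ThetaQ 4) (ThetaQ 5).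

Lemma K_classE : K_class = K_poly (Theta 1) (Theta 2) (Theta 3) (Theta 4) (Theta 6).
Proof. by []. Qed.

Lemma val_K_class : val K_class = KQ.
Proof.
exact: (rmorph_K_poly (val : {rmorphism OmegaU -> OmegaQ})
  (Theta 1) (Theta 2) (Theta 3) (Theta 4) (Theta 6)).
Qed.

Lemma val_L_class : val L_class = LQ.
Proof.
exact: (rmorph_L_poly (val : {rmorphism OmegaU -> OmegaQ})
  (Theta 1) (Theta 2) (Theta 3) (Theta 4) (Theta 5)).
Qed.

Section GradedClasses.
Variables (R : comNzRingType) (deg : nat -> R -> Prop).
Hypotheses (N : forall k, deg 0 k%:R)
  (dD : forall n x y, deg n x -> deg n y -> deg n (x + y))
  (dB : forall n x y, deg n x -> deg n y -> deg n (x - y))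
  (dM : forall n1 n2 x y, deg n1 x -> deg n2 y -> deg (n1 + n2) (x * y))
  (dX : forall n k x, deg n x -> deg (k * n) (x ^+ k)).
Variable T : nat -> R.
Hypothesis dT : forall n, deg n (T n).

(** The cases follow the ten monomials of K in order; each weight reduces to 6 by conversion. *)
Lemma graded_K_poly : deg 6 (K_poly (T 1) (T 2) (T 3) (T 4) (T 6)).
Proof.
have X n k := @dX n k _ (dT n).
rewrite /K_poly; do !first [apply: dB | apply: dD].
- exact: dT.
- exact: (dM (N 9) (X 1 6)).
- exact: (dM (dM (N 15) (X 1 4)) (dT 2)).
- exact: (dM (dM (N 3) (X 1 3)) (dT 3)).
- exact: (dM (dM (N 13) (X 1 2)) (X 2 2)).
- exact: (dM (dM (N 3) (X 1 2)) (dT 4)).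
- exact: (dM (dM (dM (N 29) (dT 1)) (dT 2)) (dT 3)).
- exact: (dM (N 10) (X 2 3)).
- exact: (dM (dM (N 11) (dT 2)) (dT 4)).
- exact: (dM (N 10) (X 3 2)).
Qed.

Lemma graded_L_poly : deg 6 (L_poly (T 1) (T 2) (T 3) (T 4) (T 5)).
Proof.
have X n k := @dX n k _ (dT n).
rewrite /L_poly; do !first [apply: dB | apply: dD].
- exact: (dM (dT 5) (dT 1)).
- exact: (dM (dM (N 3) (dT 4)) (X 1 2)).
- exact: (dM (dM (dM (N 11) (dT 3)) (dT 2)) (dT 1)).
- exact: (dM (dM (N 12) (dT 3)) (X 1 3)).
- exact: (dM (dM (N 22) (X 2 2)) (X 1 2)).
- exact: (dM (dM (N 30) (dT 2)) (X 1 4)).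
- exact: (dM (N 9) (X 1 6)).
Qed.

End GradedClasses.

Lemma in_degreeQ_KQ : in_degreeQ 6 KQ.
Proof.
exact: (graded_K_poly in_degreeQ_nat in_degreeQD in_degreeQB in_degreeQM
  in_degreeQX in_degreeQ_Theta).
Qed.

Lemma in_degreeQ_LQ : in_degreeQ 6 LQ.
Proof.
exact: (graded_L_poly in_degreeQ_nat in_degreeQD in_degreeQB in_degreeQM
  in_degreeQX in_degreeQ_Theta).
Qed.

Lemma malg_sumZ (K : choiceType) (R : nzRingType) (g : {malg R[K]}) :
  g = \sum_(k <- msupp g) g@_k *: mkmalgU k 1.
Proof.
rewrite {1}[g]monalgE; apply: eq_bigr => k _.
by apply/malgP => k'; rewrite mcoeffZ !mcoeffU mulr_natr.
Qed.

(** * The kernel of the Krichever genus *)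

Lemma KQ_split : ThetaQ 6 =
  KQ - K_poly (ThetaQ 1) (ThetaQ 2) (ThetaQ 3) (ThetaQ 4) 0.
Proof. exact: K_poly_split. Qed.

Lemma LQ_split : ThetaQ 5 * ThetaQ 1 =
  LQ - L_poly (ThetaQ 1) (ThetaQ 2) (ThetaQ 3) (ThetaQ 4) 0.
Proof. exact: L_poly_split. Qed.

Section Retraction.
(** In the application s is [psi \o Kr]. *)
Variable s : {rmorphism OmegaQ -> OmegaQ}.
Hypothesis s_fix : forall i, (i < 4)%N -> s (ThetaQ i.+1) = ThetaQ i.+1.

Lemma rmorph_fix_K_poly (R : comNzRingType) (f : {rmorphism R -> R}) t1 t2 t3 t4 :
    f t1 = t1 -> f t2 = t2 -> f t3 = t3 -> f t4 = t4 ->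
  f (- K_poly t1 t2 t3 t4 0) = - K_poly t1 t2 t3 t4 0.
Proof. by move=> f1 f2 f3 f4; rewrite rmorphN rmorph_K_poly f1 f2 f3 f4 rmorph0. Qed.

Lemma rmorph_fix_L_poly (R : comNzRingType) (f : {rmorphism R -> R}) t1 t2 t3 t4 :
    f t1 = t1 -> f t2 = t2 -> f t3 = t3 -> f t4 = t4 ->
  f (- L_poly t1 t2 t3 t4 0) = - L_poly t1 t2 t3 t4 0.
Proof. by move=> f1 f2 f3 f4; rewrite rmorphN rmorph_L_poly f1 f2 f3 f4 rmorph0. Qed.

Lemma monomial_fixed_modulo_span (m : {cmonom nat}) : theta_weight m = 6%N ->
  fixed_modulo_span s KQ LQ (mkmalgU m 1).
Proof.
move=> m6.
have fixK := rmorph_fix_K_poly (s_fix (i := 0) isT) (s_fix (i := 1) isT)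
  (s_fix (i := 2) isT) (s_fix (i := 3) isT).
have fixL := rmorph_fix_L_poly (s_fix (i := 0) isT) (s_fix (i := 1) isT)
  (s_fix (i := 2) isT) (s_fix (i := 3) isT).
(* The variable of index 5 is Theta_6, which already has weight 6, so its cofactor is 1. *)
have [m5|] := posnP (m 5); last first.
  case/cmonom_factor=> m' m_eq; rewrite m_eq theta_weightM theta_weightU in m6.
  have m'_eq : m' = mone by apply: theta_weight_eq0; lia.
  have -> : mkmalgU m 1 = ThetaQ 6 by rewrite m_eq m'_eq mulm1.
  exists 1, 0; rewrite scale1r scale0r addr0 KQ_split addrAC subrr add0r.
  exact: fixK.
(* The variable of index 4 is Theta_5; a cofactor of weight 1 must be Theta_1. *)
have [m4|] := posnP (m 4); last first.
  case/cmonom_factor=> m' m_eq; rewrite m_eq theta_weightM theta_weightU in m6.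
  have m'_eq : m' = ucm 0 by apply: theta_weight_eq1; lia.
  have -> : mkmalgU m 1 = ThetaQ 5 * ThetaQ 1.
    by rewrite m_eq m'_eq mkmalgU_factor.
  exists 0, 1; rewrite scale1r scale0r add0r LQ_split addrAC subrr add0r.
  exact: fixL.
(* Only Theta_1, ..., Theta_4 remain, and s fixes such monomials. *)
exists 0, 0; rewrite !scale0r addr0 subr0.
apply: (fixed_by_thetas s_fix) => i mi.
have := theta_weight_ge mi; rewrite m6 => i6.
have i5 : i != 5 by apply: contraL mi => /eqP ->; rewrite m5.
have i4 : i != 4 by apply: contraL mi => /eqP ->; rewrite m4.
by move: i6 i5 i4; lia.
Qed.

Lemma weight6_fixed_modulo_span (x : OmegaQ) :
  in_degreeQ 6 x -> fixed_modulo_span s KQ LQ x.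
Proof.
move=> x6; have -> : x = \sum_(m <- msupp x) x@_m *: mkmalgU m 1.
  exact: malg_sumZ.
by apply: fixed_modulo_span_sum => m /x6/monomial_fixed_modulo_span.
Qed.

End Retraction.

Lemma rmorph_rat_comb (A B : comAlgType rat) (f : {rmorphism A -> B})
    (c d : rat) x y :
  f (c *: x + d *: y) = c *: f x + d *: f y.
Proof.
have fZ : scalable f by apply/rat_linear/raddfB.
by rewrite rmorphD !fZ.
Qed.

(** Here f (x - y) = 0, so x - y = g 0 = 0. *)
Lemma eq_of_retraction (U V : zmodType) (f : {additive U -> V})
    (g : {additive V -> U}) x y :
  g (f (x - y)) = x - y -> f x = 0 -> f y = 0 -> x = y.
Proof.
move=> gf fx fy; apply/eqP.
by rewrite -subr_eq0 -gf raddfB fx fy subr0 raddf0.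
Qed.

Lemma rmorph_half (A B : comAlgType rat) (f : {rmorphism A -> B}) x h :
  f x = h *+ 2 -> f ((2^-1 : rat) *: x) = h.
Proof.
have fZ : scalable f by apply/rat_linear/raddfB.
move=> fx; rewrite fZ fx -scaler_nat scalerA.
by rewrite mulVf ?scale1r.
Qed.

Lemma rmorph_Kr_Theta_eq (R S : comNzRingType) (f : {rmorphism R -> S})
    al p p' h g al1 p1 p1' h1 :
    f al = al1 -> f p = p1 -> f p' = p1' -> f h = h1 ->
  map f (Kr_Theta al p p' h g) = Kr_Theta al1 p1 p1' h1 (f g).
Proof. by move=> <- <- <- <-; apply: rmorph_Kr_Theta. Qed.

Section KricheverKernel.
Variables (Kr : {rmorphism OmegaQ -> KrRing}) (Kr_genus : is_Krichever_genus Kr).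

Lemma Kr_ThetaE : [seq Kr (ThetaQ n) | n <- iota 1 6] =
  Kr_Theta Kr_alpha wp_z wp'_z ((2^-1 : rat) *: g2) g3.
Proof.
(* The shift by one matches Theta_n with the derivative of order n + 1. *)
rewrite -hcoef_Kr (iotaDl 1 1 6) -map_comp; apply: eq_map => n.
exact: genus_ThetaQ.
Qed.

Lemma Kr_KQ_LQ : Kr KQ = 0 /\ Kr LQ = 0.
Proof.
rewrite /KQ /LQ rmorph_K_poly rmorph_L_poly.
by apply: Kr_Theta_relations Kr_ThetaE _; rewrite -g2E.
Qed.

(* In other words, Kr is injective on Q[Theta_1, ..., Theta_4].               *)
Lemma Kr_retraction : exists psi : {rmorphism KrRing -> OmegaQ},
  forall i, (i < 4)%N -> psi (Kr (ThetaQ i.+1)) = ThetaQ i.+1.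
Proof.
have [al [p [p' [h Theta_eq]]]] :=
  Kr_Theta_onto (ThetaQ 1) (ThetaQ 2) (ThetaQ 3) (ThetaQ 4).
(* The generators go to the solutions found for Theta_1, ..., Theta_4; g2 goes to 2 h because h
   stands for g2 / 2. *)
pose psi : {rmorphism KrRing -> OmegaQ} :=
  malg_eval (fun i : 'I_4 => [:: al; p; p'; h *+ 2]`_i).
exists psi.
have psi_al : psi Kr_alpha = al by apply: malg_evalU.
have psi_p : psi wp_z = p by apply: malg_evalU.
have psi_p' : psi wp'_z = p' by apply: malg_evalU.
have psi_h : psi ((2^-1 : rat) *: g2) = h.
  by apply: rmorph_half; apply: malg_evalU.
have Theta_psi := etrans (congr1 (map psi) Kr_ThetaE)
  (rmorph_Kr_Theta_eq g3 psi_al psi_p psi_p' psi_h).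
(* [Theta_eq] holds for every last argument, in particular for [psi g3]. *)
have [e1 e2 e3 e4] := etrans (congr1 (take 4) Theta_psi) (Theta_eq (psi g3)).
case=> [|[|[|[|i]]]] lt_i4; last by exfalso; move: lt_i4.
- exact: e1.
- exact: e2.
- exact: e3.
- exact: e4.
Qed.

Lemma Kr_kernelP (x : OmegaQ) :
  Kr_kernel Kr 6 x <-> exists c d : rat, x = c *: KQ + d *: LQ.
Proof.
have [KrK KrL] := Kr_KQ_LQ.
have Kr_span c d : Kr (c *: KQ + d *: LQ) = 0.
  by rewrite (rmorph_rat_comb Kr) KrK KrL !scaler0 addr0.
split=> [[x6 Krx]|[c [d ->]]]; last first.
  split; last exact: Kr_span.
  apply: in_degreeQD; apply: in_degreeQZ; first exact: in_degreeQ_KQ.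
  exact: in_degreeQ_LQ.
have [psi psiK] := Kr_retraction.
(* The difference of x and c K + d L is fixed by [psi \o Kr], while [Kr] kills both terms. *)
have [c [d x_fix]] := @weight6_fixed_modulo_span (psi \o Kr) psiK x x6.
exists c, d; exact: eq_of_retraction x_fix Krx (Kr_span c d).
Qed.

End KricheverKernel.

(** * Linear independence of K and L, and the Buchstaber genus of K *)

Lemma class_values (R : comNzRingType) :
  [/\ K_poly 0 0 0 0 1 = 1 :> R, L_poly 0 0 0 0 0 = 0 :> R &
      L_poly 1 0 0 0 1 = 10 :> R].
Proof. by rewrite /K_poly /L_poly; split; ring. Qed.

(** With the images of t1 and t3 zero, only t6 + 10 t2^3 - 11 t2 t4 survives in K, and the terms in
    b1^3 and b1 b2 cancel. *)
Lemma rmorph_K_poly_Bc (R S : comNzRingType) (f : {rmorphism R -> S})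
    (t1 t2 t3 t4 t6 : R) (b1 b2 b3 : S) :
    f t1 = 0 -> f t2 = - b1 -> f t3 = 0 -> f t4 = b1 ^+ 2 + 12 * b2 ->
    f t6 = - b1 ^+ 3 - 132 * b1 * b2 - 360 * b3 ->
  f (K_poly t1 t2 t3 t4 t6) = - (360 * b3).
Proof.
by move=> f1 f2 f3 f4 f6; rewrite rmorph_K_poly f1 f2 f3 f4 f6 /K_poly; ring.
Qed.

Lemma rmorphN_natM (R S T : comNzRingType) (f : {rmorphism S -> T})
    (g : {rmorphism R -> S}) (n : nat) (x : R) (y : T) :
  f (g x) = y -> f (g (- (n%:R * x))) = - (n%:R * y).
Proof. by move=> <-; rewrite !rmorphN !rmorphM !rmorph_nat. Qed.

Lemma rmorph_span_classes (A B : comAlgType rat) (f : {rmorphism A -> B}) (c d : rat)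
    t1 t2 t3 t4 t5 t6 u1 u2 u3 u4 u5 u6 :
    f t1 = u1 -> f t2 = u2 -> f t3 = u3 -> f t4 = u4 -> f t5 = u5 -> f t6 = u6 ->
  f (c *: K_poly t1 t2 t3 t4 t6 + d *: L_poly t1 t2 t3 t4 t5) =
  c *: K_poly u1 u2 u3 u4 u6 + d *: L_poly u1 u2 u3 u4 u5.
Proof.
move=> <- <- <- <- <- <-.
by rewrite rmorph_rat_comb rmorph_K_poly rmorph_L_poly.
Qed.

(** Two rational points separate the classes. Where only Theta_6 = 1 is nonzero, K = 1 and L = 0;
    where only Theta_1 = Theta_5 = 1 are nonzero, L = 1 + 9 = 10. *)
Lemma KQ_LQ_independent (c d : rat) : c *: KQ + d *: LQ = 0 -> c = 0 /\ d = 0.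
Proof.
move=> cd0.
have ev (t : nat -> rat^o) : 0 =
    c *: K_poly (t 0) (t 1) (t 2) (t 3) (t 5) +
    d *: L_poly (t 0) (t 1) (t 2) (t 3) (t 4).
  rewrite -(rmorph0 (malg_eval t)) -cd0.
  exact: (rmorph_span_classes c d (malg_evalU t 0) (malg_evalU t 1)
    (malg_evalU t 2) (malg_evalU t 3) (malg_evalU t 4) (malg_evalU t 5)).
have e6 : 0 = c *: K_poly 0 0 0 0 1 + d *: L_poly 0 0 0 0 0 :> rat^o :=
  ev (fun i => if i == 5 then 1 else 0).
have e51 : 0 = c *: K_poly 1 0 0 0 0 + d *: L_poly 1 0 0 0 1 :> rat^o :=
  ev (fun i => if (i == 0) || (i == 4) then 1 else 0).
have [K6 L6 L51] := class_values rat^o.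
have c0 : c = 0 by rewrite e6 K6 L6 scaler0 addr0 [_ *: _]mulr1.
split=> //; move/esym/eqP: e51; rewrite c0 scale0r add0r L51 scaler_eq0.
by rewrite pnatr_eq0 orbF => /eqP.
Qed.

Section BuchstaberClass.
Variables (Bc : {rmorphism OmegaU -> BcRing Zhalf}).
Hypothesis Bc_genus : is_Buchstaber_genus Bc.

Let val_rat : {rmorphism Zhalf -> rat} := val.

(** The genus followed by the inclusion of Z[1/2] into the rationals on coefficients, where its
    exponential is defined. *)
Let Bc_rat : {rmorphism OmegaU -> BcRing rat} :=
  map_malg_rmorphism {cmonom 'I_3} val_rat \o Bc.

Lemma Bc_ThetaE : [seq Bc_rat (Theta n) | n <- iota 1 6] =
  [:: 0; - a1 rat; 0; a1 rat ^+ 2 + 12 * a2 rat; 0;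
      - a1 rat ^+ 3 - 132 * a1 rat * a2 rat - 360 * a3 rat].
Proof.
rewrite -hcoef_Bc (iotaDl 1 1 6) -map_comp; apply: eq_map => n.
exact: genus_Theta.
Qed.

Lemma Bc_rat_K : Bc_rat K_class = - (360 * a3 rat).
Proof.
have [e1 e2 e3 e4 _ e6] := Bc_ThetaE.
rewrite K_classE.
have := @rmorph_K_poly_Bc _ _ Bc_rat _ _ _ _ _ _ _ _ e1 e2 e3 e4 e6.
exact.
Qed.

Lemma Bc_K : Bc K_class =
  map_malg (fun c : int => c%:~R : Zhalf) (- (360 * a3 int)).
Proof.
(* The inclusion of coefficients is injective, so both sides are compared over the rationals. *)
apply: (@map_malg_inj _ _ _ val_rat val_inj).
have -> : map_malg val_rat (Bc K_class) = Bc_rat K_class by [].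
rewrite Bc_rat_K; apply: esym.
pose i : {rmorphism int -> Zhalf} := intr.
have a3E : map_malg_rmorphism {cmonom 'I_3} val_rat
    (map_malg_rmorphism {cmonom 'I_3} i (a3 int)) = a3 rat.
  by rewrite -!map_malgE !map_malgU.
have := @rmorphN_natM _ _ _ (map_malg_rmorphism {cmonom 'I_3} val_rat)
  (map_malg_rmorphism {cmonom 'I_3} i) 360 _ _ a3E.
exact.
Qed.

End BuchstaberClass.

Lemma big_I2 (V : nmodType) (F : 'I_2 -> V) : \sum_i F i = F ord0 + F ord_max.
Proof. by rewrite big_ord_recl big_ord1; congr (_ + F _); apply: val_inj. Qed.

Theorem proposition3p5
    (Bc : {rmorphism OmegaU -> BcRing Zhalf}) (Bc_genus : is_Buchstaber_genus Bc)
    (Kr : {rmorphism OmegaQ -> KrRing}) (Kr_genus : is_Krichever_genus Kr) :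
  [/\ in_degree 6 K_class,
      Bc K_class = map_malg (fun c : int => c%:~R : Zhalf) (- (360 * a3 int)) &
      Kr (val K_class) = 0]
  /\
  [/\ has_dimension (Kr_kernel Kr 6) 2 &
      generated_by (Kr_kernel Kr 6)
        (fun i : 'I_2 => val (if i == ord0 then K_class else L_class))].

Proof.
split; first split.
- by rewrite /in_degree val_K_class; apply: in_degreeQ_KQ.
- exact: Bc_K.
- by rewrite val_K_class; have [] := Kr_KQ_LQ Kr_genus.
have sum2 (c : 'I_2 -> rat) :
    \sum_i c i *: val (if i == ord0 then K_class else L_class) =
    c ord0 *: KQ + c ord_max *: LQ.
  apply: etrans (big_I2 _) _.
  exact: (congr2 (fun a b => c ord0 *: a + c ord_max *: b) val_K_class val_L_class).
have kernel_span : generated_by (Kr_kernel Kr 6)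
    (fun i : 'I_2 => val (if i == ord0 then K_class else L_class)).
  move=> x; split=> [/(Kr_kernelP Kr_genus)[c [d x_eq]]|[c x_eq]].
    by exists (fun i => if i == ord0 then c else d); rewrite sum2.
  by apply/(Kr_kernelP Kr_genus); exists (c ord0), (c ord_max); rewrite x_eq sum2.
split=> //.
(* The generating family K, L is itself a basis. *)
exists (fun i : 'I_2 => val (if i == ord0 then K_class else L_class)).
split=> // c; rewrite sum2 => /KQ_LQ_independent[c0 c1] i.
have [->|->] // : i = ord0 \/ i = ord_max.
by case: i => -[|[|]] // ?; [left|right]; apply: val_inj.
Qed.
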